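(* Let $\mathcal H$ be a real Hilbert space, let $m$ be a strictly positive integer, and let $(\omega_i)_{1\leq i\leq m}\in\,]0,1]^m$ satisfy $\sum_{i=1}^m\omega_i=1$. Let $C_0$ be a nonempty closed convex subset of $\mathcal H$ and, for every $i\in\{1,\ldots,m\}$, let $\mathcal G_i$ be a real Hilbert space, let $L_i\colon\mathcal H\to\mathcal G_i$ be a nonzero bounded linear operator, let $D_i$ be a nonempty closed convex subset of $\mathcal G_i$, let $\mu_i\in\,]0,+\infty[$, and let $\phi_i\colon\mathbb R\to[0,+\infty[$ be an even differentiable convex function that vanishes only at $0$ and such that $\phi_i'$ is $\mu_i$-Lipschitzian. A minimizer over $C_0$ of the function $x\mapsto\sum_{i=1}^m\omega_i\phi_i\big(d_{D_i}(L_ix)\big)$ is called a solution. Suppose that one of the following holds: [a] There exists $j\in\{1,\ldots,m\}$ such that $\lim_{\|x\|\to+\infty}\big(\iota_{C_0}(x)+\phi_j(d_{D_j}(L_jx))\big)=+\infty$. [b] There exists $j\in\{1,\ldots,m\}$ such that $\operatorname{ran}L_j$ is closed, $C_0\subset(\ker L_j)^\perp$, and $D_j$ is bounded. [c] There exists $j\in\{1,\ldots,m\}$ such that $\mathcal G_j=\mathcal H$, $L_j=\operatorname{Id}$, and $D_j$ is bounded. [d] $C_0$ is bounded. Set $\beta=1/(\max_{1\leq i\leq m}\mu_i\|L_i\|^2)$ and let $\gamma\in\,]0,2\beta[$. Let $K$ be a strictly positive integer and let $(I_n)_{n\in\mathbb N}$ be a sequence of nonempty subsets of $\{1,\ldots,m\}$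 such that $\bigcup_{k=0}^{K-1}I_{n+k}=\{1,\ldots,m\}$ for every $n\in\mathbb N$. Let $x_0\in C_0$, let $(t_{i,-1})_{1\leq i\leq m}\in\mathcal H^m$, and define iteratively, for $n=0,1,\ldots$: for every $i\in I_n$, $$t_{i,n}=\begin{cases}x_n-\gamma\,\dfrac{\phi_i'\big(d_{D_i}(L_ix_n)\big)}{d_{D_i}(L_ix_n)}\,L_i^*\big(L_ix_n-\operatorname{proj}_{D_i}(L_ix_n)\big),&\text{if } L_ix_n\notin D_i;\\ x_n,&\text{if } L_ix_n\in D_i,\end{cases}$$ for every $i\in\{1,\ldots,m\}\smallsetminus I_n$, $t_{i,n}=t_{i,n-1}$, and $$x_{n+1}=\operatorname{proj}_{C_0}\Big(\sum_{i=1}^m\omega_it_{i,n}\Big).$$ Then the following hold: (i) $(x_n)_{n\in\mathbb N}$ converges weakly to a solution. (ii) Suppose that one of the following holds: [e] condition [b] is satisfied with the additional assumptions (for the same index $j$) that $\phi_j=\mu_j|\cdot|^2/2$ and $D_j$ is compact; [f] $C_0$ is boundedly compact. Then $(x_n)_{n\in\mathbb N}$ converges strongly to a solution.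
   Context: For a nonempty closed convex set $C$ in a Hilbert space, $\operatorname{proj}_C$ is the projector onto $C$, $d_C$ is the distance function to $C$, and $\iota_C$ is the indicator function, equal to $0$ on $C$ and $+\infty$ elsewhere. $L^*$ denotes the adjoint of $L$. A subset is boundedly compact if its intersection with every closed ball is compact. *)

(* Defs.v *)
From HB Require Import structures.
From mathcomp Require Import all_boot all_order all_algebra sesquilinear.
From mathcomp Require Import all_classical all_reals all_analysis.

Set Implicit Arguments.
Unset Strict Implicit.
Unset Printing Implicit Defensive.

Import Order.TTheory GRing.Theory Num.Theory.
Import numFieldNormedType.Exports.

Local Open Scope classical_set_scope.
Local Open Scope ring_scope.

(* A real Hilbert space: a complete normed module whose norm is induced by a
   symmetric, positive definite bilinear form. *)
HB.mixin Record CompleteNormedModule_isHilbert (R : realType) H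
    & CompleteNormedModule R H := {
  hdot : {dot H for (@idfun R)} ;
  sqr_norm_hdot : forall x : H, `|x| ^+ 2 = hdot x x
}.

#[short(type="hilbertType")]
HB.structure Definition Hilbert (R : realType) :=
  {H of CompleteNormedModule_isHilbert R H & CompleteNormedModule R H}.

Notation "''[' x , y ]" := (hdot x y) : ring_scope.

Section hilbert.
Context {R : realType}.
Implicit Types H G : hilbertType R.

Definition weak_cvg H (u : nat -> H) (l : H) : Prop :=
  forall z : H, '[u n, z] @[n --> \oo] --> '[l, z].

Definition orthogonal_complement H (A : set H) : set H :=
  [set x | forall y, A y -> '[x, y] = 0].

Definition ker_set H G (L : H -> G) : set H := L @^-1` [set 0].

Definition opnorm H G (L : H -> G) : R :=
  sup [set `|L x| | x in [set x : H | `|x| <= 1]].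

(* For a bounded linear [L] the vector selected below exists and is unique,
   by the Riesz representation theorem; the default value 0 is never used. *)
Definition adjoint H G (L : H -> G) (y : G) : H :=
  xget 0 [set z : H | forall x : H, '[L x, y] = '[x, z]].

(* [G = H] is an equality of Hilbert spaces, hence also of their inner products;
   the cast is only needed to compare [L x : G] with [x : H]. *)
Definition is_Id H G (L : H -> G) : Prop :=
  exists e : H = G, forall x : H, L x = ecast V (V : hilbertType R) e x.

(* Meaningful only for nonempty [C], as [inf set0 = 0]. *)
Definition dist_set H (C : set H) (x : H) : R := inf [set `|x - y| | y in C].

(* When [C] is nonempty, closed and convex, the nearest point exists and is
   unique; the default value 0 is never used. *)
Definition proj_set H (C : set H) (x : H) : H :=
  xget 0 [set p : H | C p /\ `|x - p| = dist_set C x].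

Definition iota_set (T : Type) (C : set T) (x : T) : \bar R :=
  if x \in C then 0%E else +oo%E.

Definition boundedly_compact H (C : set H) : Prop :=
  forall (x : H) (r : R), 0 < r -> compact (C `&` closed_ball x r).

(* The filter of the limits as [`|x|] tends to infinity. *)
Definition norm_pinfty H : set_system H :=
  filter_from [set: R] (fun M => [set x : H | M < `|x|]).

Definition argmin (T : Type) (C : set T) (f : T -> R) : set T :=
  [set x | C x /\ forall y, C y -> f x <= f y].

End hilbert.

Arguments norm_pinfty {R} H.

(* Main.v *)
Require Import Defs.
From HB Require Import structures.
From mathcomp Require Import all_boot all_order all_algebra sesquilinear.
From mathcomp Require Import all_classical all_reals all_analysis.
From mathcomp Require Import ring lra zify.

Set Implicit Arguments.
Unset Strict Implicit.
Unset Printing Implicit Defensive.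

Import Order.TTheory GRing.Theory Num.Theory.
Import numFieldNormedType.Exports.

Local Open Scope classical_set_scope.
Local Open Scope ring_scope.

(* Write h_i for the function phi_i o d_{D_i} o L_i, g_i for its gradient and F for
   the weighted sum of the h_i.  A subgradient inequality and a quadratic upper
   bound for phi_i o d_{D_i}, both obtained directly from the projection, give the
   cocoercivity of g_i without any differentiability in H.

   Each t_{i,n} is a gradient step for h_i from some iterate of the last K ones.
   For a solution z, the squared distance of x_{n+1} to z is bounded by a weighted
   mean of those of these iterates, minus residuals.  As x_n itself has a weight
   bounded away from 0, the squared distances converge (not only their maxima over
   K successive indices) and the residuals vanish.  Hence g_i (x_n) -> g_i z and
   <grad F (x_n), x_n - z> -> 0, so F (x_n) tends to the minimum and every weak
   cluster point is a solution; Opial's argument gives weak convergence.  Weak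
   cluster points are limits along ultrafilters, obtained from Riesz'
   representation theorem.

   Under [b], Baire's theorem and the weak compactness of balls give
   |x| <= M |L_j x| on the orthogonal of ker L_j; it yields coercivity, and turns
   the strong convergence of L_j^* L_j x_n under [e] into that of x_n. *)

(** * Inner product identities and the Cauchy-Schwarz inequality *)

Section inner_product.
Context {R : realType} {H : hilbertType R}.
Implicit Types x y z : H.

Lemma hdotC x y : '[x, y] = '[y, x].
Proof. by rewrite (hermC (@hdot R H)) expr0 mul1r. Qed.

Lemma hdotDl x y z : '[x + y, z] = '[x, z] + '[y, z].
Proof. exact: linearDl. Qed.

Lemma hdotNl x z : '[- x, z] = - '[x, z].
Proof. exact: linearNl. Qed.

Lemma hdotZl a x z : '[a *: x, z] = a * '[x, z].
Proof. exact: linearZl_LR. Qed.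

Lemma hdotDr x y z : '[z, x + y] = '[z, x] + '[z, y].
Proof. exact: linearDr. Qed.

Lemma hdotNr x z : '[z, - x] = - '[z, x].
Proof. exact: linearNr. Qed.

Lemma hdotZr a x z : '[z, a *: x] = a * '[z, x].
Proof. by rewrite hdotC hdotZl hdotC. Qed.

Lemma hdot0l z : '[0, z] = 0.
Proof. exact: linear0l. Qed.

Lemma hdot0r z : '[z, 0] = 0.
Proof. exact: linear0r. Qed.

Lemma hdotBl x y z : '[x - y, z] = '[x, z] - '[y, z].
Proof. by rewrite hdotDl hdotNl. Qed.

Lemma hdotBr x y z : '[z, x - y] = '[z, x] - '[z, y].
Proof. by rewrite hdotDr hdotNr. Qed.

Lemma hdot_suml (I : finType) (F : I -> H) z :
  '[\sum_i F i, z] = \sum_i '[F i, z].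
Proof. by apply: (big_morph (fun x => '[x, z])) => [x y|]; rewrite ?hdotDl ?hdot0l. Qed.

Definition hdotE := (hdotDl, hdotDr, hdotNl, hdotNr, hdotZl, hdotZr).

Lemma normD_sqr x y : `|x + y| ^+ 2 = `|x| ^+ 2 + 2 * '[x, y] + `|y| ^+ 2.
Proof. rewrite !sqr_norm_hdot !hdotE (hdotC y x); ring. Qed.

Lemma normB_sqr x y : `|x - y| ^+ 2 = `|x| ^+ 2 - 2 * '[x, y] + `|y| ^+ 2.
Proof. rewrite !sqr_norm_hdot !hdotE (hdotC y x); ring. Qed.

Lemma hdot_le x y : '[x, y] <= `|x| * `|y|.
Proof.
have [->|y0] := eqVneq y 0; first by rewrite hdot0r normr0 mulr0.
have y1 : 0 < `|y| by rewrite normr_gt0.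
have [->|x0] := eqVneq x 0; first by rewrite hdot0l normr0 mul0r.
have x1 : 0 < `|x| by rewrite normr_gt0.
have := sqr_ge0 `|(`|y| *: x) - (`|x| *: y)|.
rewrite normB_sqr !normrZ !normr_id hdotZl hdotZr => h.
have {}h : 0 <= 2 * (`|x| * `|y|) * (`|x| * `|y| - '[x, y]) by lra.
by move: h; rewrite pmulr_rge0 ?subr_ge0// mulr_gt0// mulr_gt0.
Qed.

Lemma norm_hdot_le x y : `|'[x, y]| <= `|x| * `|y|.
Proof.
rewrite ler_norml hdot_le andbT -normrN lerNl -hdotNl.
exact: hdot_le.
Qed.

Lemma hdotx_eq0 x : '[x, x] = 0 -> x = 0.
Proof.
by rewrite -sqr_norm_hdot => /eqP; rewrite expf_eq0/= normr_eq0 => /eqP.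
Qed.

Lemma hdot_extl x y : (forall z, '[x, z] = '[y, z]) -> x = y.
Proof.
move=> xy; apply/eqP; rewrite -subr_eq0; apply/eqP/hdotx_eq0.
by rewrite hdotBl xy subrr.
Qed.

Lemma cvg_hdotr (T : Type) (F : set_system T) {FF : Filter F} (u : T -> H) l z :
  u @ F --> l -> '[z, u n] @[n --> F] --> '[z, l].
Proof.
move=> ul; apply/cvgrPdist_le => e e0.
have z1 : 0 < `|z| + 1 by rewrite ltr_pwDr.
have d0 : 0 < e / (`|z| + 1) by rewrite divr_gt0.
move/cvgrPdist_le : ul => /(_ _ d0); apply: filterS => n.
rewrite -hdotBr ler_pdivlMr// => ln.
rewrite (le_trans (norm_hdot_le _ _))// (le_trans _ ln)//.
by rewrite mulrC ler_wpM2l// lerDl.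
Qed.

Lemma cvg_hdotl (T : Type) (F : set_system T) {FF : Filter F} (u : T -> H) l z :
  u @ F --> l -> '[u n, z] @[n --> F] --> '[l, z].
Proof.
by move=> /(cvg_hdotr (z := z)); rewrite hdotC; under eq_fun do rewrite hdotC.
Qed.

End inner_product.

(** * Projections, Riesz representation and adjoints *)

Lemma convex_setP (R : realType) (H : hilbertType R) (C : set H) x y (s : R) :
  convex_set C -> C x -> C y -> 0 <= s -> s <= 1 ->
  C (x + s *: (y - x)).
Proof.
move=> Ccvx Cx Cy s0 s1.
have := Ccvx y x (Itv01 s0 s1); rewrite !inE => /(_ Cy Cx).
congr (C _); rewrite /conv /=.
by rewrite scalerBr scalerBl scale1r addrCA addrA addrAC.
Qed.

Section projection.
Context {R : realType} {H : hilbertType R} (C : set H).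
Implicit Types x y p : H.

Lemma has_inf_dist x : C !=set0 -> has_inf [set `|x - y| | y in C].
Proof. by move=> [y Cy]; split; [exists `|x - y|, y | exists 0 => _ [z _ <-]]. Qed.

Lemma dist_set_le x y : C y -> dist_set C x <= `|x - y|.
Proof. by move=> Cy; apply: ge_inf; [exists 0 => _ [z _ <-] | exists y]. Qed.

Lemma dist_set_ge0 x : 0 <= dist_set C x.
Proof.
have [->|/set0P C0] := eqVneq C set0; first by rewrite /dist_set image_set0 inf0.
by apply: lb_le_inf => [|_ [z _ <-]//]; case: C0 => y Cy; exists `|x - y|, y.
Qed.

Hypotheses (C0 : C !=set0) (Ccl : closed C) (Ccvx : convex_set C).

Lemma nearest_point_exists x : exists p, C p /\ `|x - p| = dist_set C x.
Proof.
set d := dist_set C x; have d0 : 0 <= d := dist_set_ge0 x.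
pose B e := [set y | C y /\ `|x - y| < d + e].
have B0 e : 0 < e -> B e !=set0.
  move=> e0; have [_ [y Cy <-] xy] := inf_adherent e0 (has_inf_dist x C0).
  by exists y.
have FF : ProperFilter (filter_from [set e : R | 0 < e] B).
  apply: filter_from_proper; last by move=> e /B0.
  apply: filter_from_filter; first by exists 1 => /=.
  move=> e f /= e0 f0; exists (Num.min e f) => [/=|y [Cy xy]].
    by rewrite lt_min e0.
  by split; split => //; apply: (lt_le_trans xy); rewrite lerD2l ge_min lexx ?orbT.
have sq (a b : R) : 0 <= a -> a ^+ 2 < b ^+ 2 -> 0 < b -> a < b.
  by move=> a0 ab b0; rewrite -(@ltr_pXn2r _ 2%N)// nnegrE ltW.
(* The parallelogram law makes the sets of almost nearest points shrink. *)
have small e : 0 < e -> exists2 s, 0 < s &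
    forall y z, B s y -> B s z -> `|y - z| < e.
  (* Comparison with the midpoint bounds [|y - z|^2] by [4 * ((d + s)^2 - d^2)], which is at most
     [s * (8 * d + 4)] once [s <= 1]. *)
  move=> e0; exists (Num.min 1 (e ^+ 2 / (8 * d + 8))).
    by rewrite lt_min ltr01 divr_gt0// ?exprn_gt0//; lra.
  set s := Num.min _ _.
  have s0 : 0 < s by rewrite lt_min ltr01 divr_gt0// ?exprn_gt0//; lra.
  have s1 : s <= 1 by rewrite ge_min lexx.
  have se : s * (8 * d + 8) <= e ^+ 2.
    by rewrite -ler_pdivlMr ?ge_min ?lexx ?orbT//; lra.
  move=> y z [Cy xy] [Cz xz]; apply: sq => //.
  have h : d <= `|x - (y + 2^-1 *: (z - y))|.
    by apply: dist_set_le; apply: convex_setP => //; lra.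
  have {}h : d ^+ 2 <= `|x - (y + 2^-1 *: (z - y))| ^+ 2 by rewrite ler_pXn2r// nnegrE.
  have hy : `|x - y| ^+ 2 <= (d + s) ^+ 2.
    by rewrite ler_pXn2r ?nnegrE//; [exact: ltW|exact: addr_ge0 d0 (ltW s0)].
  have hz : `|x - z| ^+ 2 <= (d + s) ^+ 2.
    by rewrite ler_pXn2r ?nnegrE//; [exact: ltW|exact: addr_ge0 d0 (ltW s0)].
  have ss : s ^+ 2 <= s by rewrite expr2 ler_piMl// ltW.
  move: h hy hz se; rewrite !sqr_norm_hdot !hdotE.
  rewrite (hdotC y x) (hdotC z x) (hdotC z y) => h hy hz se.
  lra.
have /cauchy_cvg /cvg_ex[p pF] : cauchy (filter_from [set e : R | 0 < e] B).
  apply: cauchy_exP => e e0; have [s s0 hs] := small _ e0.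
  have [y By] := B0 _ s0; exists y; exists s => // z Bz.
  by rewrite -ball_normE; exact: hs.
have Cp : C p.
  apply: (@closed_cvg _ _ _ FF id C Ccl _ p pF); exists 1; first exact: ltr01.
  by move=> y [].
exists p; split=> //; apply/eqP; rewrite eq_le dist_set_le// andbT.
apply/ler_addgt0Pr => e e0.
have /(@cvgr_dist_lt _ H _ _ FF id p pF)[s s0 ps] : 0 < e / 2 by lra.
have m0 : 0 < Num.min s (e / 2) by rewrite lt_min s0/=; lra.
have [y [Cy xy]] := B0 _ m0.
have /ps : B s y by split=> //; apply: (lt_le_trans xy); rewrite lerD2l ge_min lexx.
have : `|x - y| < d + e / 2.
  by apply: (lt_le_trans xy); rewrite lerD2l ge_min lexx orbT.
have := ler_normD (x - y) (y - p); rewrite addrA subrK (distrC y p) -/d/=; lra.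
Qed.

Lemma proj_setP x : C (proj_set C x) /\ `|x - proj_set C x| = dist_set C x.
Proof. by have := xgetPex 0 (nearest_point_exists x). Qed.

Lemma proj_set_in x : C (proj_set C x). Proof. by have [] := proj_setP x. Qed.

Lemma dist_setE x : dist_set C x = `|x - proj_set C x|.
Proof. by have [_ ->] := proj_setP x. Qed.

(** Nearness of [p] compared with the points [p + s (y - p)] of [C], to first order in [s]. *)
Lemma proj_set_hdot_le0 x y : C y -> '[x - proj_set C x, y - proj_set C x] <= 0.
Proof.
move=> Cy; set p := proj_set C x.
have h s : 0 <= s -> s <= 1 ->
    2 * s * '[x - p, y - p] <= s ^+ 2 * `|y - p| ^+ 2.
  move=> s0 s1; have : dist_set C x <= `|x - (p + s *: (y - p))|.
    by apply: dist_set_le; apply: convex_setP => //; exact: proj_set_in.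
  rewrite dist_setE -/p => le_p.
  have {}le_p : `|x - p| ^+ 2 <= `|x - (p + s *: (y - p))| ^+ 2 by rewrite ler_pXn2r ?nnegrE.
  move: le_p; rewrite opprD addrA [leRHS]normB_sqr normrZ exprMn.
  by rewrite real_normK ?num_real// hdotZr; lra.
rewrite leNgt; apply/negP => c0; set c := '[_, _] in h c0.
have [yp0|yp0] := eqVneq `|y - p| 0.
  by have := h 1 ler01 (lexx _); rewrite yp0; lra.
have n0 : 0 < `|y - p| ^+ 2 by rewrite exprn_gt0// lt_neqAle eq_sym yp0 /=.
set n := `|y - p| ^+ 2 in h n0.
(* With [s * n <= c], the bound [h] would give [2 * s * c <= s * c]. *)
pose s := Num.min 1 (c / n).
have s0 : 0 < s by rewrite lt_min ltr01 divr_gt0.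
have sn : s * n <= c by rewrite -ler_pdivlMr// ge_min lexx orbT.
have := h s (ltW s0); rewrite ge_min lexx => /(_ isT); nra.
Qed.

Lemma proj_set_id x : C x -> proj_set C x = x.
Proof.
move=> Cx; apply/eqP; rewrite eq_sym -subr_eq0; apply/eqP/hdotx_eq0/eqP.
by rewrite eq_le proj_set_hdot_le0//= -sqr_norm_hdot sqr_ge0.
Qed.

(** Sum of the two variational inequalities, each tested at the other projection; the subtracted
    term later yields the residual [q]. *)
Lemma proj_set_firm x y :
  `|proj_set C x - proj_set C y| ^+ 2 <=
    `|x - y| ^+ 2 - `|(x - proj_set C x) - (y - proj_set C y)| ^+ 2.
Proof.
have := proj_set_hdot_le0 x (proj_set_in y).
have := proj_set_hdot_le0 y (proj_set_in x).
set p := proj_set C x; set q := proj_set C y.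
rewrite !sqr_norm_hdot !hdotE (hdotC p x) (hdotC q x) (hdotC q y) (hdotC p y).
rewrite (hdotC y x) (hdotC q p); lra.
Qed.

End projection.

(** Converse of the variational inequality, used to recognize a solution as a fixed point of the
    projected gradient step. *)
Lemma proj_set_unique (R : realType) (H : hilbertType R) (C : set H) x p :
  C !=set0 -> closed C -> convex_set C ->
  C p -> (forall y, C y -> '[x - p, y - p] <= 0) -> proj_set C x = p.
Proof.
move=> C0 Ccl Ccvx Cp px; set q := proj_set C x.
have h1 : '[x - p, q - p] <= 0 by apply: px; exact: proj_set_in.
have h2 : '[x - q, p - q] <= 0 by exact: proj_set_hdot_le0.
apply/eqP; rewrite -subr_eq0; apply/eqP/hdotx_eq0/eqP.
rewrite eq_le -{2}sqr_norm_hdot sqr_ge0 andbT.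
move: h1 h2; rewrite !hdotE; rewrite (hdotC q p); lra.
Qed.

Lemma lipschitz_le_continuous (R : realType) (V W : normedModType R) (f : V -> W) M :
  (forall x y, `|f x - f y| <= M * `|x - y|) -> continuous f.
Proof.
move=> fM x; apply/cvgrPdist_le => e e0.
have M1 : 0 < `|M| + 1 by rewrite ltr_pwDr.
have d0 : 0 < e / (`|M| + 1) by rewrite divr_gt0.
near=> y; rewrite (le_trans (fM _ _))//.
have : `|x - y| <= e / (`|M| + 1) by near: y; exact: cvgr_dist_le.
rewrite ler_pdivlMr//; apply: le_trans.
by rewrite mulrC ler_wpM2l// (le_trans (ler_norm _))// lerDl.
Unshelve. all: by end_near. Qed.

Section riesz.
Context {R : realType} {H : hilbertType R}.

(** The representer is a multiple of the projection [p] of 0 onto the hyperplane [l = 1], closed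
    since [l] is bounded: [p] is orthogonal to the kernel of [l]. *)
Lemma riesz (l : H -> R) (M : R) :
  (forall x y, l (x + y) = l x + l y) -> (forall a x, l (a *: x) = a * l x) ->
  (forall x, `|l x| <= M * `|x|) -> exists z, forall x, l x = '[x, z].
Proof.
move=> lD lZ lM.
have lB x y : l (x - y) = l x - l y by rewrite lD -scaleN1r lZ mulN1r.
have [l0|/existsNP[x0 lx0]] := pselect (forall x, l x = 0).
  by exists 0 => x; rewrite l0 hdot0r.
pose C := [set x | l x = 1].
have C0 : C !=set0.
  by exists ((l x0)^-1 *: x0); rewrite /C /= lZ mulVf//; exact/eqP.
have lc : continuous (l : H -> R^o).
  by apply: (@lipschitz_le_continuous _ _ _ _ M) => x y; rewrite -lB.
have Ccl : closed C.
  by apply: (preimage_closed (D := [set 1 : R^o])) => [x _|]; [exact: lc|exact: closed_eq].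
have Ccvx : convex_set C.
  move=> x y s; rewrite !inE /C /= => lx ly.
  by rewrite /conv/= lD !lZ lx ly !mulr1 subrKC.
set p := proj_set C 0; have lp : l p = 1 by exact: (proj_set_in C0 Ccl Ccvx 0).
have pk k : l k = 0 -> '[p, k] <= 0.
  move=> lk; have Cpk : C (p - k) by rewrite /C /= lB lk subr0.
  have := proj_set_hdot_le0 C0 Ccl Ccvx 0 Cpk; rewrite -/p.
  by rewrite sub0r addrAC subrr sub0r hdotNl hdotNr opprK.
have pp : '[p, p] != 0.
  apply/eqP => /hdotx_eq0 p0; move: lp; rewrite p0 -(scale0r 0) lZ mul0r.
  by move=> /esym/eqP; rewrite oner_eq0.
exists ('[p, p]^-1 *: p) => x.
have kx : l (x - l x *: p) = 0 by rewrite lB lZ lp mulr1 subrr.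
have kx' : l (- (x - l x *: p)) = 0 by rewrite -scaleN1r lZ kx mulr0.
have /eqP : '[p, x - l x *: p] = 0.
  by apply/eqP; rewrite eq_le pk//= -oppr_le0 -hdotNr pk.
rewrite !hdotE subr_eq0 => /eqP; rewrite hdotC => ->.
by rewrite mulrCA mulVf// mulr1.
Qed.

End riesz.

Section bounded_linear.
Context {R : realType} {H G : hilbertType R} (L : {linear H -> G}).
Hypothesis Lb : bounded_near L (nbhs (0 : H)).

Let opnorm_ubound : has_ubound [set `|L x| | x in [set x : H | `|x| <= 1]].
Proof.
move: Lb => /linear_boundedP/pinfty_ex_gt0[M M0 LM].
exists M => _ [y /= y1 <-]; rewrite (le_trans (LM _))//.
by rewrite -[leRHS]mulr1 ler_wpM2l// ltW.
Qed.

Lemma opnorm_ge0 : 0 <= opnorm L.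
Proof.
by apply: (ub_le_sup opnorm_ubound); exists 0; rewrite /= ?linear0 normr0.
Qed.

Lemma opnorm_le x : `|L x| <= opnorm L * `|x|.
Proof.
have [->|x0] := eqVneq x 0; first by rewrite linear0 !normr0 mulr0.
have x1 : 0 < `|x| by rewrite normr_gt0.
rewrite -ler_pdivrMr//.
apply: (ub_le_sup opnorm_ubound); exists (`|x|^-1 *: x) => /=.
  by rewrite normrZ normfV normr_id mulVf// gt_eqF.
by rewrite linearZ/= normrZ normfV normr_id mulrC.
Qed.

Lemma opnorm_gt0 : (exists x, L x != 0) -> 0 < opnorm L.
Proof.
move=> [x]; rewrite -normr_gt0 => Lx; rewrite lt_neqAle opnorm_ge0 andbT.
apply/eqP => o0; have := lt_le_trans Lx (opnorm_le x).
by rewrite -o0 mul0r ltxx.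
Qed.

Lemma adjointP x y : '[L x, y] = '[x, adjoint L y].
Proof.
have : exists z, forall x, '[L x, y] = '[x, z].
  apply: (@riesz _ _ _ (opnorm L * `|y|)) => [u v|a u|u].
  - by rewrite linearD hdotDl.
  - by rewrite linearZ hdotZl.
  - rewrite (le_trans (norm_hdot_le _ _))// mulrAC ler_wpM2r//.
    exact: opnorm_le.
by move=> /(xgetPex 0); apply.
Qed.

Lemma adjointB y z : adjoint L (y - z) = adjoint L y - adjoint L z.
Proof.
by apply: hdot_extl => x; rewrite hdotC -adjointP hdotBr !adjointP hdotBl !(hdotC x).
Qed.

Lemma adjointZ a y : adjoint L (a *: y) = a *: adjoint L y.
Proof.
by apply: hdot_extl => x; rewrite hdotC -adjointP hdotZr !adjointP hdotZl !(hdotC x).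
Qed.

Lemma adjoint_norm_le y : `|adjoint L y| <= opnorm L * `|y|.
Proof.
have [->|z0] := eqVneq (adjoint L y) 0.
  by rewrite normr0 mulr_ge0// opnorm_ge0.
have z1 : 0 < `|adjoint L y| by rewrite normr_gt0.
rewrite -(ler_pM2r z1) -expr2 sqr_norm_hdot -adjointP.
rewrite (le_trans (hdot_le _ _))// mulrAC ler_wpM2r//.
exact: opnorm_le.
Qed.

End bounded_linear.

(** * Ultrafilters and weak limits *)

Section ultrafilters.
Context {T : Type}.

(** If [u] missed a neighbourhood [A] of [l], the trace of [F] on the complement of the preimage of
    [A] would extend to an ultrafilter containing both sets. Limits can thus be checked along
    ultrafilters, in place of subsequences. *)
Lemma ultra_cvg (V : topologicalType) (F : set_system T) {FF : ProperFilter F}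
    (u : T -> V) (l : V) :
  (forall U, UltraFilter U -> F `<=` U -> u @ U --> l) -> u @ F --> l.
Proof.
move=> ul A Al; rewrite /fmap/= /nbhs/=; apply: contrapT => nFA.
have PF : ProperFilter (within (~` (u @^-1` A)) F).
  split; last exact: within_filter.
  move=> F0; apply: nFA.
  by apply: (@filterS _ F _ [set t | ~ ~ A (u t)]) F0 => t /contrapT.
have [U [UU sU]] := ultraFilterLemma PF.
have UA : U (u @^-1` A).
  apply: ul Al => // B FB; apply: sU.
  by rewrite /within/=; apply: (@filterS _ F _ B) FB => t.
have /(filterI UA) : U (~` (u @^-1` A)).
  by apply: sU; rewrite /within/=; apply: filterE.
by rewrite setICr; exact: filter_not_empty.
Qed.

Context (U : set_system T) {UU : UltraFilter U}.

Lemma ultra_cvg_compact (V : topologicalType) (A : set V) (u : T -> V) :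
  compact A -> (forall t, A (u t)) -> exists2 p, A p & u @ U --> p.
Proof.
move=> Aco uA; have [|p [Ap pU]] := Aco (u @ U) _.
  exact: (@filterE _ U _ (u @^-1` A)).
exists p => // B Bp; have [//|/= UB] := in_ultra_setVsetC (u @^-1` B) UU.
by have [q []] := pU (~` B) B UB Bp.
Qed.

End ultrafilters.

Lemma cvg_le_cst (R : realType) (T : Type) (F : set_system T)
    {FF : ProperFilter F} (f : T -> R) (l c : R) :
  f @ F --> l -> (\forall t \near F, f t <= c) -> l <= c.
Proof. by move=> fl fc; exact: (closed_cvg (fun x => x <= c) (@closed_le R c) fc _ fl). Qed.

Lemma cvg_ge_cst (R : realType) (T : Type) (F : set_system T)
    {FF : ProperFilter F} (f : T -> R) (l c : R) :
  f @ F --> l -> (\forall t \near F, c <= f t) -> c <= l.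
Proof. by move=> fl fc; exact: (closed_cvg (fun x => c <= x) (@closed_ge R c) fc _ fl). Qed.

Lemma sqr_cvg0 (R : realType) (T : Type) (F : set_system T) {FF : Filter F}
    (u : T -> R) :
  (forall t, 0 <= u t) -> u t ^+ 2 @[t --> F] --> 0 -> u @ F --> 0.
Proof.
move=> u0 u2; rewrite -[X in _ --> X](sqrtr0 R).
have -> : u = (fun t => Num.sqrt (u t ^+ 2)).
  by apply/funext => t; rewrite sqrtr_sqr ger0_norm.
by apply: (continuous_cvg _ _ u2); exact: sqrt_continuous.
Qed.

(** [weak_cvg] along an arbitrary filter, so that ultrafilters apply. *)
Definition weakly_to (R : realType) (H : hilbertType R) (T : Type)
    (F : set_system T) (u : T -> H) (l : H) :=
  forall z, '[u t, z] @[t --> F] --> '[l, z].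

Section weak_limits.
Context {R : realType} {H : hilbertType R} {T : Type}.
Implicit Types (u : T -> H) (F U : set_system T).

(** Each ['[u t, z]] lies in a segment and so converges along [U]; the limits form a bounded linear
    functional of [z], which Riesz' theorem represents. *)
Lemma ultra_weakly_to U {UU : UltraFilter U} u M :
  (forall t, `|u t| <= M) -> exists z, weakly_to U u z.
Proof.
move=> uM.
have ex z : exists l : R, '[u t, z] @[t --> U] --> l.
  pose B := M * `|z|.
  have [|l _ ul] := @ultra_cvg_compact _ U _ R `[- B, B]%classic
      (fun t => '[u t, z]) (@segment_compact _ _ _).
    move=> t; rewrite /= in_itv/= -ler_norml (le_trans (norm_hdot_le _ _))//.
    by rewrite ler_wpM2r.
  by exists l.
have /choice[l lP] := ex.
have [|||z zP] := @riesz _ H l M.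
- move=> x y; apply: (cvg_unique _ (lP (x + y))) => //=.
  by under eq_fun do rewrite hdotDr; exact: cvgD.
- move=> a x; apply: (cvg_unique _ (lP (a *: x))) => //=.
  by under eq_fun do rewrite hdotZr; apply: cvgM => //; exact: cvg_cst.
- move=> x; apply: (cvg_le_cst (cvg_norm (lP x))).
  apply: filterE => t; rewrite (le_trans (norm_hdot_le _ _))//.
  by rewrite ler_wpM2r.
by exists z => x; rewrite hdotC -zP.
Qed.

Context (F : set_system T) {FF : ProperFilter F}.

Lemma weakly_to_unique u y z : weakly_to F u y -> weakly_to F u z -> y = z.
Proof.
by move=> uy uz; apply: hdot_extl => x; exact: (cvg_unique _ (uy x) (uz x)).
Qed.

Lemma cvg_weakly_to u z : u @ F --> z -> weakly_to F u z.
Proof. by move=> uz x; exact: cvg_hdotl. Qed.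

Lemma weakly_to_adjoint (G : hilbertType R) (L : {linear H -> G}) u z :
  bounded_near L (nbhs (0 : H)) -> weakly_to F u z ->
  forall x, '[L (u t), x] @[t --> F] --> '[L z, x].
Proof.
move=> Lb uz x; under eq_fun do rewrite (adjointP Lb).
by rewrite (adjointP Lb); exact: uz.
Qed.

(** With [p] the projection of [z], the inequality ['[z - p, u t - p] <= 0] passes to the limit and
    gives [z = p]. *)
Lemma weakly_to_closed_convex (C : set H) u z :
  C !=set0 -> closed C -> convex_set C -> (forall t, C (u t)) ->
  weakly_to F u z -> C z.
Proof.
move=> C0 Ccl Ccvx uC uz; set p := proj_set C z.
suff <- : p = z by exact: proj_set_in.
apply/eqP; rewrite eq_sym -subr_eq0; apply/eqP/hdotx_eq0/eqP.
rewrite eq_le -{2}sqr_norm_hdot sqr_ge0 andbT hdotBl subr_le0.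
apply: (cvg_le_cst (uz (z - p))).
apply: filterE => t; rewrite -subr_le0 -hdotBl hdotC.
exact: proj_set_hdot_le0.
Qed.

Lemma weakly_to_norm_le u z M : (forall t, `|u t| <= M) -> weakly_to F u z ->
  `|z| <= M.
Proof.
move=> uM uz; have [->|z0] := eqVneq z 0.
  have [t _] : exists t : T, True.
    by have [t _] := filter_ex (@filterT _ F _); exists t.
  by rewrite normr0 (le_trans _ (uM t)).
have z1 : 0 < `|z| by rewrite normr_gt0.
rewrite -(ler_pM2r z1) -expr2 sqr_norm_hdot.
apply: (cvg_le_cst (uz z)).
by apply: filterE => t; rewrite (le_trans (hdot_le _ _))// ler_wpM2r.
Qed.

End weak_limits.

(** * Losses of the distance to a convex set *)

(** Mean value theorem for [q], the left side minus the right side: its derivative [dq] is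
    nonnegative left of [s] and nonpositive right of it. *)
Lemma derive1_lipschitz_le (R : realType) (f : R -> R) (mu s r : R) :
  (forall x, derivable f x 1) -> mu.-lipschitz (derive1 f) ->
  f r <= f s + derive1 f s * (r - s) + mu / 2 * (r - s) ^+ 2.
Proof.
move=> fd flip.
have lip x y : x <= y -> `|derive1 f y - derive1 f x| <= mu * (y - x).
  move=> xy; have /= := flip (y, x) (conj I I).
  by rewrite (ger0_norm (_ : 0 <= y - x)) ?subr_ge0.
pose q (y : R) : R := f y - (f s + derive1 f s * (y - s) + mu / 2 * (y - s) ^+ 2).
pose dq (y : R) : R := derive1 f y - (derive1 f s + mu * (y - s)).
have qd (x : R) : is_derive x 1 q (dq x).
  have fx : is_derive (x : R) 1 f (derive1 f x) by rewrite derive1E; exact: derivableP.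
  by apply: is_derive_eq; rewrite /dq /GRing.scale /=; lra.
have qc : continuous q.
  by move=> x; apply/differentiable_continuous/derivable1_diffP; case: (qd x).
have qs : q s = 0 by rewrite /q subrr expr2 !mulr0 !addr0 subrr.
rewrite -subr_le0 -/(q r).
have [rs|sr|->] := ltgtP r s; last by rewrite qs.
- have [c] := MVT rs (fun x _ => qd x) (continuous_subspaceT qc).
  rewrite in_itv/= qs sub0r => /andP[rc cs] e.
  have := lip _ _ (ltW cs); rewrite ler_norml => /andP[h1 h2].
  have dqc : 0 <= dq c by rewrite /dq; lra.
  nra.
- have [c] := MVT sr (fun x _ => qd x) (continuous_subspaceT qc).
  rewrite in_itv/= qs subr0 => /andP[sc cr] e.
  have := lip _ _ (ltW sc); rewrite ler_norml => /andP[h1 h2].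
  have dqc : dq c <= 0 by rewrite /dq; lra.
  nra.
Qed.

Section loss.
Context {R : realType} (phi : R -> R) (mu : R).
Hypotheses (phi_ge0 : forall s, 0 <= phi s)
  (phi_derivable : forall s, derivable phi s 1)
  (phi_convex : convex_function (E := R^o) [set: R] phi)
  (phi_eq0 : forall s, phi s = 0 <-> s = 0)
  (mu_gt0 : 0 < mu)
  (phi_lipschitz : mu.-lipschitz (derive1 phi)).

Lemma loss_conv (s r t : R) : 0 <= t -> t <= 1 ->
  phi (s + t * (r - s)) <= phi s + t * (phi r - phi s).
Proof.
move=> t0 t1; have := phi_convex (Itv01 t0 t1).
move=> /(_ r s); rewrite !inE => /(_ I I); rewrite /conv/= /GRing.scale/=.
move=> h; apply: le_trans (le_trans h _).
  by rewrite (_ : s + _ = t * r + (1 - t) * s)//; ring.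
change (t * phi r + (1 - t) * phi s <= phi s + t * (phi r - phi s)).
by lra.
Qed.

(** The quadratic bound for [- phi] gives the tangent inequality up to an error of order two;
    convexity along the segment to [r] removes it. *)
Lemma loss_tangent_le (s r : R) : phi s + derive1 phi s * (r - s) <= phi r.
Proof.
have low y : phi s + derive1 phi s * (y - s) - mu / 2 * (y - s) ^+ 2 <= phi y.
  have Nd x : derivable (\- phi) x 1 by apply: derivableN.
  have dN x : derive1 (\- phi) x = - derive1 phi x by rewrite derive1N.
  have lipN : mu.-lipschitz (derive1 (\- phi)).
    by move=> xy hxy /=; rewrite !dN -opprD normrN; exact: phi_lipschitz.
  have /= := derive1_lipschitz_le s y Nd lipN.
  by rewrite dN /=; lra.
rewrite leNgt; apply/negP => lt0.
pose e := phi s + derive1 phi s * (r - s) - phi r; have e0 : 0 < e by rewrite subr_gt0.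
pose k := mu / 2 * (r - s) ^+ 2; have k0 : 0 <= k by rewrite mulr_ge0 ?sqr_ge0// ltW// divr_gt0.
(* A gap [e] would give [t * e <= t^2 * k], which fails since [t * (k + 1) < e]; the division by 2
   makes this strict. *)
pose t := Num.min 1 (e / (k + 1)) / 2.
have m0 : 0 < Num.min 1 (e / (k + 1)) by rewrite lt_min ltr01 divr_gt0//; lra.
have m1 : Num.min 1 (e / (k + 1)) <= 1 by rewrite ge_min lexx.
have t0 : 0 < t by rewrite /t; lra.
have t1 : t <= 1 by rewrite /t; lra.
have te : t * (k + 1) < e.
  by rewrite -ltr_pdivlMr; [|lra]; rewrite /t; have : Num.min 1 (e / (k + 1)) <= e / (k + 1);
    [rewrite ge_min lexx orbT|lra].
have := loss_conv s r (ltW t0) t1; have := low (s + t * (r - s)).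
rewrite (_ : s + t * (r - s) - s = t * (r - s)); last by ring.
move=> h1 h2.
have : t * (e - t * k) <= 0 by rewrite /e /k; lra.
rewrite pmulr_rle0// subr_le0; lra.
Qed.

Lemma loss0 : phi 0 = 0. Proof. exact/phi_eq0. Qed.

Lemma loss_nondecreasing (s r : R) : 0 <= s -> s <= r -> phi s <= phi r.
Proof.
move=> s0 sr; have [r0|r0] := eqVneq r 0.
  by have -> : s = 0 by [lra]; rewrite loss0.
have r1 : 0 < r by rewrite lt_neqAle eq_sym r0 (le_trans s0).
have t0 : 0 <= s / r by rewrite divr_ge0// ltW.
have t1 : s / r <= 1 by rewrite ler_pdivrMr// mul1r.
have := loss_conv 0 r t0 t1; rewrite loss0 !subr0 !add0r divfK// => /le_trans; apply.
by rewrite ler_piMl.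
Qed.

Lemma loss_linear_growth (r : R) : 1 <= r -> phi 1 * r <= phi r.
Proof.
move=> r1; have r0 : 0 < r by lra.
have t0 : 0 <= r^-1 by rewrite invr_ge0 ltW.
have t1 : r^-1 <= 1 by rewrite invf_le1.
have := loss_conv 0 r t0 t1; rewrite loss0 !subr0 !add0r mulVf ?gt_eqF//.
by rewrite mulrC ler_pdivlMr// mulrC.
Qed.

Lemma loss1_gt0 : 0 < phi 1.
Proof.
by rewrite lt_neqAle phi_ge0 andbT eq_sym; apply/eqP => /phi_eq0/eqP; rewrite oner_eq0.
Qed.

Lemma derive1_loss_ge0 (d : R) : 0 < d -> 0 <= derive1 phi d.
Proof.
move=> d0; have := loss_tangent_le d 0; rewrite loss0 sub0r mulrN subr_le0.
by move=> h; rewrite -(pmulr_lge0 _ d0) (le_trans _ h).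
Qed.

Lemma derive1_loss0 : derive1 phi 0 = 0.
Proof.
have d0 : is_derive (0 : R) 1 phi 0.
  apply: (@derive1_at_min _ phi (-1) 1 0) => //.
    by rewrite in_itv/= ltrN10 ltr01.
  by move=> t _; rewrite loss0.
by rewrite derive1E derive_val.
Qed.

Lemma derive1_loss_le (d : R) : 0 <= d -> derive1 phi d <= mu * d.
Proof.
move=> d0; have /= := @phi_lipschitz (d, 0) (conj I I).
by rewrite derive1_loss0 !subr0 (ger0_norm d0); apply: le_trans; exact: ler_norm.
Qed.

Lemma loss_quadratic_le (s r : R) :
  phi r <= phi s + derive1 phi s * (r - s) + mu / 2 * (r - s) ^+ 2.
Proof. exact: derive1_lipschitz_le. Qed.

End loss.

(** * Subgradient selections, cocoercivity and their transport through a linear operator *)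

Definition subgradient (R : realType) (H : hilbertType R) (f : H -> R) (g : H -> H) :=
  forall x y, f x + '[g x, y - x] <= f y.

Definition cocoercive (R : realType) (H : hilbertType R) (beta : R) (g : H -> H) :=
  forall x y, beta * `|g x - g y| ^+ 2 <= '[g x - g y, x - y].

Section cocoercivity.
Context {R : realType} {H : hilbertType R}.
Implicit Types (f : H -> R) (g : H -> H).

(* Baillon-Haddad: compare the two bounds at [y - mu^-1 *: (g y - g x)]. *)
Lemma descent_cocoercive f g (mu : R) : 0 < mu -> subgradient f g ->
  (forall x y, f y <= f x + '[g x, y - x] + mu / 2 * `|y - x| ^+ 2) ->
  cocoercive mu^-1 g.
Proof.
move=> mu0 fg fd.
have half x y : f x + '[g x, y - x] + mu^-1 / 2 * `|g y - g x| ^+ 2 <= f y.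
  pose w := y - mu^-1 *: (g y - g x).
  have := le_trans (fg x w) (fd y w).
  have -> : w - x = y - x - mu^-1 *: (g y - g x) by rewrite /w addrAC.
  have -> : w - y = - (mu^-1 *: (g y - g x)) by rewrite /w addrAC subrr sub0r.
  rewrite normrN normrZ exprMn real_normK ?num_real//.
  rewrite (_ : mu / 2 * _ = mu^-1 / 2 * `|g y - g x| ^+ 2); last by field; lra.
  rewrite !sqr_norm_hdot !hdotE (hdotC (g y) (g x)); lra.
move=> x y; have := half x y; have := half y x.
rewrite (distrC (g y)) hdotBl -(opprB x y) hdotNr; lra.
Qed.

Lemma cocoercive_lipschitz (beta : R) g : 0 < beta -> cocoercive beta g ->
  forall x y, `|g x - g y| <= beta^-1 * `|x - y|.
Proof.
move=> b0 gc x y; rewrite ler_pdivlMl//.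
have [->|n0] := eqVneq `|g x - g y| 0; first by rewrite mulr0.
have n1 : 0 < `|g x - g y| by rewrite lt_neqAle eq_sym n0 /=.
rewrite -(ler_pM2r n1) -mulrA -expr2 (le_trans (gc x y))//.
by rewrite (le_trans (hdot_le _ _))// mulrC.
Qed.

Lemma cocoercive_continuous (beta : R) g : 0 < beta -> cocoercive beta g ->
  continuous g.
Proof.
move=> b0 /(cocoercive_lipschitz b0); exact: lipschitz_le_continuous.
Qed.

Lemma subgradient_comp (G : hilbertType R) (L : {linear H -> G}) (h : G -> R) psi :
  bounded_near L (nbhs (0 : H)) -> subgradient h psi ->
  subgradient (h \o L) (fun x => adjoint L (psi (L x))).
Proof.
move=> Lb hpsi x y /=.
by rewrite hdotC -(adjointP Lb) (linearB L) hdotC; exact: hpsi.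
Qed.

(** Passing to the adjoint costs a factor [opnorm L ^+ 2], absorbed by the bound on [beta]. *)
Lemma cocoercive_comp (G : hilbertType R) (L : {linear H -> G}) (mu beta : R) psi :
  bounded_near L (nbhs (0 : H)) -> 0 < mu -> 0 < beta ->
  beta * (mu * opnorm L ^+ 2) <= 1 ->
  cocoercive mu^-1 psi -> cocoercive beta (fun x => adjoint L (psi (L x))).
Proof.
move=> Lb mu0 b0 bmu pc x y /=.
rewrite -(adjointB Lb) hdotC -(adjointP Lb) (linearB L) hdotC.
apply: le_trans (pc (L x) (L y)); set d := _ - _.
have : `|adjoint L d| ^+ 2 <= opnorm L ^+ 2 * `|d| ^+ 2.
  by rewrite -exprMn ler_pXn2r ?nnegrE ?mulr_ge0 ?opnorm_ge0 ?adjoint_norm_le.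
move=> /(ler_wpM2l (ltW b0)) /le_trans; apply.
rewrite mulrA ler_wpM2r ?sqr_ge0// -(ler_pM2r mu0) mulVf ?gt_eqF//.
by apply: le_trans bmu; rewrite le_eqVlt; apply/orP; left; apply/eqP; ring.
Qed.

End cocoercivity.

Section distance_loss.
Context {R : realType} {G : hilbertType R} (D : set G) (phi : R -> R) (mu : R).
Hypotheses (D0 : D !=set0) (Dcl : closed D) (Dcvx : convex_set D).
Hypotheses (phi_ge0 : forall s, 0 <= phi s)
  (phi_derivable : forall s, derivable phi s 1)
  (phi_convex : convex_function (E := R^o) [set: R] phi)
  (phi_eq0 : forall s, phi s = 0 <-> s = 0)
  (mu_gt0 : 0 < mu)
  (phi_lipschitz : mu.-lipschitz (derive1 phi)).

(* On [D] this is [0], both [dist_set D u] and [u - proj_set D u] being [0]. *)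
Definition dist_loss_grad (u : G) : G :=
  (derive1 phi (dist_set D u) / dist_set D u) *: (u - proj_set D u).

Local Notation d := (dist_set D).
Local Notation P := (proj_set D).

Lemma dist_loss_grad_in u : D u -> dist_loss_grad u = 0.
Proof. by move=> Du; rewrite /dist_loss_grad proj_set_id// subrr scaler0. Qed.

Lemma dist_set_eq0 u : d u = 0 -> u = P u.
Proof.
by rewrite dist_setE// => /eqP; rewrite normr_eq0 subr_eq0 => /eqP.
Qed.

Lemma dist_loss_subgradient : subgradient (phi \o d) dist_loss_grad.
Proof.
move=> u v /=; have [du0|du0] := eqVneq (d u) 0.
  by rewrite /dist_loss_grad du0 invr0 mulr0 scale0r hdot0l addr0 (loss0 phi_eq0).
have d0 : 0 < d u by rewrite lt_neqAle eq_sym du0 dist_set_ge0.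
apply: le_trans (loss_tangent_le phi_derivable phi_convex mu_gt0 phi_lipschitz (d u) (d v)).
have p0 := derive1_loss_ge0 phi_ge0 phi_derivable phi_convex phi_eq0 mu_gt0 phi_lipschitz d0.
(* What remains is that [(u - P u) / d u] is a subgradient of the distance at [u]: the projection
   inequality at [P v] plus Cauchy-Schwarz for [v - P v]. *)
rewrite lerD2l /dist_loss_grad hdotZl -mulrA ler_wpM2l// ler_pdivrMl//.
have h := proj_set_hdot_le0 D0 Dcl Dcvx u (proj_set_in D0 Dcl Dcvx v).
have := hdot_le (u - P u) (v - P v); rewrite -!dist_setE// => h1.
have : '[u - P u, u - P u] = d u * d u by rewrite -sqr_norm_hdot -dist_setE.
move: h h1; rewrite !hdotE; lra.
Qed.

(** The projection is frozen at [P u]: [d v <= |v - P u|], and the scalar quadratic bound is applied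
    between [d u] and [|v - P u|]. *)
Lemma dist_loss_descent u v :
  phi (d v) <= phi (d u) + '[dist_loss_grad u, v - u] + mu / 2 * `|v - u| ^+ 2.
Proof.
have q := loss_quadratic_le phi_derivable phi_lipschitz.
have dv : d v <= `|v - P u| by apply: dist_set_le; exact: proj_set_in.
have p1 : phi (d v) <= phi `|v - P u|.
  exact: (loss_nondecreasing phi_ge0 phi_convex phi_eq0 (dist_set_ge0 _ _)).
apply: (le_trans p1); have [du0|du0] := eqVneq (d u) 0.
  have := q 0 `|v - P u|; rewrite -(dist_set_eq0 du0).
  rewrite (derive1_loss0 phi_ge0 phi_derivable phi_eq0) mul0r addr0 subr0.
  by rewrite /dist_loss_grad du0 invr0 mulr0 scale0r hdot0l addr0.
have d0 : 0 < d u by rewrite lt_neqAle eq_sym du0 dist_set_ge0.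
apply: (le_trans (q (d u) _)).
(* [c] is the component of [v - u] along the unit normal [(u - P u) / d u]. *)
have [c cE] : exists c, '[u - P u, v - u] = c * d u.
  by exists ('[u - P u, v - u] / d u); rewrite divfK.
have -> : '[dist_loss_grad u, v - u] = derive1 phi (d u) * c.
  by rewrite /dist_loss_grad hdotZl cE mulrAC -!mulrA mulfV// mulr1.
have le := derive1_loss_le phi_ge0 phi_derivable phi_eq0 phi_lipschitz (ltW d0).
have vP : v - P u = (u - P u) + (v - u) by rewrite [RHS]addrC addrA subrK.
have nv : `|v - P u| ^+ 2 = d u ^+ 2 + 2 * (c * d u) + `|v - u| ^+ 2.
  by rewrite vP normD_sqr cE -dist_setE.
have rc : 0 <= `|v - P u| - d u - c.
  rewrite -(pmulr_rge0 _ d0).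
  have := hdot_le (u - P u) (v - P u); rewrite -dist_setE// vP hdotDr cE -vP.
  rewrite -sqr_norm_hdot -dist_setE// expr2 (mulrC c) -mulrDr => h.
  by rewrite -addrA -opprD mulrBr subr_ge0.
(* This product of two slacks is exactly the difference of the two sides. *)
have := mulr_ge0 rc (_ : 0 <= mu * d u - derive1 phi (d u)).
rewrite subr_ge0 => /(_ le).
have -> : `|v - u| ^+ 2 = `|v - P u| ^+ 2 - d u ^+ 2 - 2 * (c * d u) by lra.
lra.
Qed.

Lemma dist_loss_cocoercive : cocoercive mu^-1 dist_loss_grad.
Proof. exact: descent_cocoercive mu_gt0 dist_loss_subgradient dist_loss_descent. Qed.

End distance_loss.

(** * The block iteration *)

Section windowed_descent.
Context {R : realType} (a r : nat -> R) (K : nat) (w : R).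
Hypotheses (a_ge0 : forall n, 0 <= a n) (r_ge0 : forall n, 0 <= r n).
Hypotheses (w_gt0 : 0 < w) (w_le1 : w <= 1).

Let W n := \big[Num.max/0]_(k < K.+1) a (n + k)%N.

Hypothesis a_descent : forall n, a (n + K.+1)%N + r n <= w * a (n + K)%N + (1 - w) * W n.

Let W_ge n k : (k <= K)%N -> a (n + k)%N <= W n.
Proof.
move=> kK; have := le_bigmax 0 (fun i : 'I_K.+1 => a (n + i)%N) (inord k).
by rewrite inordK.
Qed.

Let W_le n c : 0 <= c -> (forall k, (k <= K)%N -> a (n + k)%N <= c) -> W n <= c.
Proof. by move=> c0 ac; apply: bigmax_le => // i _; apply: ac; rewrite -ltnS. Qed.

Let W_ge0 n : 0 <= W n. Proof. exact: le_trans (W_ge n (leq0n K)). Qed.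

Let a_le n : a (n + K.+1)%N <= W n.
Proof.
have := a_descent n; have := r_ge0 n; have := W_ge n (leqnn K).
have : 0 <= w * (W n - a (n + K)%N) by rewrite mulr_ge0 ?subr_ge0 ?W_ge// ltW.
lra.
Qed.

Let W_dec n : W n.+1 <= W n.
Proof.
apply: W_le => // k kK; rewrite addSnnS; move: kK; rewrite leq_eqVlt => /orP[/eqP ->|kK].
  exact: a_le.
exact: W_ge.
Qed.

Let W_noninc n k : W (n + k)%N <= W n.
Proof. by elim: k => [|k]; rewrite ?addn0 ?addnS//; exact: le_trans. Qed.

(** Each step gives weight [w] to the latest value, so a gap below the maximum at [n + K] survives,
    shrunk by [w] per step. *)
Let a_drop n j : a (n + K + j)%N <= W n - w ^+ j * (W n - a (n + K)%N).
Proof.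
elim: j => [|j IH]; first by rewrite addn0 expr0 mul1r; lra.
have := a_descent (n + j)%N; have := r_ge0 (n + j)%N; have := W_noninc n j.
rewrite (_ : n + j + K.+1 = n + K + j.+1)%N; last by lia.
rewrite (_ : n + j + K = n + K + j)%N; last by lia.
rewrite exprS -mulrA => h1 h2 h3.
have := ler_wpM2l (ltW w_gt0) IH.
have : 0 <= (1 - w) * (W n - W (n + j)%N) by rewrite mulr_ge0 ?subr_ge0.
lra.
Qed.

(** The window starting at [n + K] has only indices to which [a_drop] applies with [j <= K]; a gap
    therefore lowers the maximum. *)
Let W_drop n : w ^+ K * (W n - a (n + K)%N) <= W n - W (n + K)%N.
Proof.
have d0 : 0 <= W n - a (n + K)%N by rewrite subr_ge0 W_ge.
have wK : w ^+ K * (W n - a (n + K)%N) <= W n - a (n + K)%N.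
  by rewrite ler_piMl// exprn_ile1// ltW.
rewrite lerBrDr addrC -lerBrDr; apply: W_le => [|k kK].
  by have := a_ge0 (n + K)%N; lra.
apply: (le_trans (a_drop n k)); rewrite lerD2l lerN2 ler_wpM2r//.
by rewrite ler_wiXn2l// ltW.
Qed.

(** The nonincreasing [W] converges, so by [W_drop] the gaps vanish and [a] has the same limit; [r]
    is squeezed by the slack of [a_descent]. *)
Lemma windowed_descent_cvg : cvgn a /\ r @ \oo --> 0.
Proof.
have Wc : cvgn W.
  apply: nonincreasing_is_cvgn; first by apply/nonincreasing_seqP.
  by exists 0 => _ [n _ <-].
set l := limn W in Wc *.
have WK : W (n + K)%N @[n --> \oo] --> l by rewrite cvg_shiftn.
have wK0 : 0 < w ^+ K by rewrite exprn_gt0.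
have dc : W n - a (n + K)%N @[n --> \oo] --> 0.
  have dW : (w ^+ K)^-1 * (W n - W (n + K)%N) @[n --> \oo] --> 0.
    rewrite -[X in _ --> X](mulr0 (w ^+ K)^-1) -(subrr l).
    by apply: cvgM; [exact: cvg_cst|exact: cvgB].
  apply: (squeeze_cvgr _ (cvg_cst 0) dW); apply: nearW => n.
  by rewrite subr_ge0 W_ge//= ler_pdivlMl// W_drop.
have aK : a (n + K)%N @[n --> \oo] --> l.
  rewrite -[X in _ --> X]subr0.
  have -> : (fun n => a (n + K)%N) = (fun n => W n - (W n - a (n + K)%N)).
    by apply/funext => n; rewrite subKr.
  exact: cvgB.
have al : a @ \oo --> l by rewrite -(cvg_shiftn K).
split; first by apply/cvg_ex; exists l.
have bc : w * a (n + K)%N + (1 - w) * W n - a (n + K.+1)%N @[n --> \oo] --> 0.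
  rewrite -[X in _ --> X](_ : w * l + (1 - w) * l - l = 0); last by ring.
  apply: cvgB; last by rewrite (cvg_shiftn K.+1).
  by apply: cvgD; apply: cvgM => //; exact: cvg_cst.
apply: (squeeze_cvgr _ (cvg_cst 0) bc); apply: nearW => n.
by rewrite r_ge0/=; have := a_descent n; lra.
Qed.

End windowed_descent.

Section weighted_mean.
Context {R : realType} {H : hilbertType R} {m : nat} (w : 'I_m -> R).
Hypothesis w_sum : \sum_i w i = 1.

(** The variance term is kept because it forces the [e n i] of the iteration to merge. *)
Lemma weighted_variance (e : 'I_m -> H) :
  `|\sum_i w i *: e i| ^+ 2 + \sum_i w i * `|e i - \sum_k w k *: e k| ^+ 2 =
  \sum_i w i * `|e i| ^+ 2.
Proof.
set b := \sum_i w i *: e i.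
have bb : \sum_i w i * '[e i, b] = `|b| ^+ 2.
  by rewrite sqr_norm_hdot {2}/b hdot_suml; apply: eq_bigr => i _; rewrite hdotZl.
have -> : \sum_i w i * `|e i - b| ^+ 2 =
    \sum_i w i * `|e i| ^+ 2 - 2 * (\sum_i w i * '[e i, b]) + (\sum_i w i) * `|b| ^+ 2.
  rewrite mulr_sumr mulr_suml -sumrB -big_split /=; apply: eq_bigr => i _.
  by rewrite normB_sqr; ring.
by rewrite bb w_sum; lra.
Qed.

End weighted_mean.

(** * Optimality and existence of constrained minimizers *)

Section constrained_minimization.
Context {R : realType} {H : hilbertType R} (C : set H) (f : H -> R) (g : H -> H).
Hypotheses (C0 : C !=set0) (Ccl : closed C) (Ccvx : convex_set C).
Hypothesis (fg : subgradient f g).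

(** The subgradient at [z_ n], tested at [z], gives the sign along the segment to [y]; continuity of
    [g] carries it to [z]. *)
Lemma argmin_variational (z y : H) : continuous g -> argmin C f z -> C y ->
  0 <= '[g z, y - z].
Proof.
move=> gc [Cz zmin] Cy.
pose z_ n := z + harmonic n *: (y - z).
have Cz_ n : C (z_ n).
  by apply: convex_setP => //; [exact: harmonic_ge0|rewrite /harmonic invf_le1// ler1n].
have z_z : z_ @ \oo --> z.
  rewrite -[X in _ --> X]addr0 -(scale0r (y - z)).
  by apply: cvgD; [exact: cvg_cst|apply: cvgZr_tmp; exact: cvg_harmonic].
have ge0 n : 0 <= '[g (z_ n), y - z].
  have := le_trans (fg (z_ n) z) (zmin _ (Cz_ n)).
  rewrite gerDl (_ : z - z_ n = - (harmonic n *: (y - z))); last by rewrite opprD addrA subrr sub0r.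
  by rewrite hdotNr hdotZr oppr_le0 pmulr_rge0// harmonic_gt0.
have lim : '[g (z_ n), y - z] @[n --> \oo] --> '[g z, y - z].
  by apply: cvg_hdotl; apply: (continuous_cvg _ _ z_z); exact: gc.
by apply: (cvg_ge_cst lim); exact: nearW.
Qed.

(** Weak lower semicontinuity, read off the affine minorant given by the subgradient at [z]. *)
Lemma weakly_to_le (T : Type) (F : set_system T) {FF : ProperFilter F}
    (u : T -> H) (v : T -> R) z c :
  weakly_to F u z -> (forall t, f (u t) <= v t) -> v @ F --> c -> f z <= c.
Proof.
move=> uz uv vc.
have lim : v t + ('[z, g z] - '[u t, g z]) @[t --> F] --> c.
  rewrite -[X in _ --> X]addr0 -(subrr '[z, g z]).
  by apply: cvgD => //; apply: cvgB; [exact: cvg_cst|exact: uz].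
apply: (cvg_ge_cst lim); apply: nearW => t; have := fg z (u t); have := uv t.
by rewrite hdotC hdotBl; lra.
Qed.

(** Direct method: coercivity bounds a minimizing sequence, whose weak limit along an ultrafilter is
    a minimizer. *)
Lemma argmin_exists : (forall x, C x -> 0 <= f x) ->
  (forall B, exists M, forall x, C x -> f x <= B -> `|x| <= M) ->
  exists z, argmin C f z.
Proof.
move=> f_ge0 coercive; pose S := f @` C.
have infS : has_inf S.
  split; first by have [y Cy] := C0; exists (f y), y.
  by exists 0 => _ [x Cx <-]; exact: f_ge0.
have /choice[u uP] n : exists x, C x /\ f x <= inf S + harmonic n.
  have [_ [x Cx <-] fx] := inf_adherent (harmonic_gt0 n) infS.
  by exists x; split => //; exact: ltW.
have [M uM] := coercive (inf S + 1).
have ub n : `|u n| <= M.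
  have [Cu fu] := uP n; apply: uM => //; apply: (le_trans fu).
  by rewrite lerD2l /harmonic invf_le1// ler1n.
have [U [UU sU]] := @ultraFilterLemma nat \oo _.
have [z zP] := ultra_weakly_to ub.
exists z; split.
  by apply: (weakly_to_closed_convex C0 Ccl Ccvx _ zP) => n; case: (uP n).
move=> y Cy; apply: (@le_trans _ _ (inf S)); last first.
  by apply: ge_inf; [case: infS|exists y].
apply: (weakly_to_le zP (v := fun n => inf S + harmonic n)).
  by move=> n; case: (uP n).
rewrite -[X in _ --> X]addr0; apply: cvgD; first exact: cvg_cst.
by apply: cvg_trans (@cvg_harmonic R); move=> A /= hA; exact: sU.
Qed.

End constrained_minimization.

Section block_activation.
Context {R : realType} {H : hilbertType R} {m : nat} (I : nat -> set 'I_m)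
  (T : 'I_m -> H -> H) (x : nat -> H) (t : nat -> 'I_m -> H) (t_init : 'I_m -> H).
Hypotheses (t_active : forall n i, I n i -> t n i = T i (x n))
  (t_idle : forall n i, ~ I n i -> t n i = if n is n'.+1 then t n' i else t_init i).

(** [l] is the latest activation of [i], found by induction on [n]; the last clause ensures that a
    block active at [n] uses [x n] itself. *)
Lemma last_activation n j i : I j i -> (j <= n)%N ->
  exists l, [/\ (j <= l <= n)%N, t n i = T i (x l) & I n i -> l = n].
Proof.
move=> Iji; elim: n => [|n IH] jn.
  have j0 : j = 0%N by lia.
  by exists 0%N; rewrite j0 -t_active//; rewrite j0 in Iji.
have [In|nIn] := pselect (I n.+1 i).
  by exists n.+1; rewrite jn leqnn; split=> //; exact: t_active.
have jn' : (j <= n)%N.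
  move: jn; rewrite leq_eqVlt => /orP[/eqP jE|//].
  by move: Iji; rewrite jE.
have [l [/andP[jl ln] tl _]] := IH jn'.
by exists l; split; [lia|rewrite t_idle|].
Qed.

End block_activation.

Section block_iteration.
Context {R : realType} {H : hilbertType R} {m : nat}.
Context (w : 'I_m -> R) (C : set H) (f : 'I_m -> H -> R) (g : 'I_m -> H -> H).
Context (beta gamma : R) (K : nat).
Hypotheses (w_gt0 : forall i, 0 < w i) (w_sum : \sum_i w i = 1).
Hypotheses (C0 : C !=set0) (Ccl : closed C) (Ccvx : convex_set C).
Hypotheses (fg : forall i, subgradient (f i) (g i))
  (gc : forall i, cocoercive beta (g i)).
Hypotheses (gamma_gt0 : 0 < gamma) (gamma_lt : gamma < 2 * beta).
Context (I : nat -> set 'I_m) (x : nat -> H) (t : nat -> 'I_m -> H)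
  (t_init : 'I_m -> H).
Hypotheses (I_neq0 : forall n, I n !=set0)
  (I_cover : forall n i, exists2 k, (k <= K)%N & I (n + k)%N i)
  (t_active : forall n i, I n i -> t n i = x n - gamma *: g i (x n))
  (t_idle : forall n i, ~ I n i -> t n i = if n is n'.+1 then t n' i else t_init i)
  (x0_in : C (x 0%N))
  (x_step : forall n, x n.+1 = proj_set C (\sum_i w i *: t n i)).

Let F y := \sum_i w i * f i y.
Let dF y := \sum_i w i *: g i y.

Let beta_gt0 : 0 < beta.
Proof. by have := lt_trans gamma_gt0 gamma_lt; rewrite pmulr_rgt0. Qed.

Lemma sum_subgradient : subgradient F dF.
Proof.
move=> y z; rewrite /F /dF hdot_suml -big_split /=; apply: ler_sum => i _.
by rewrite hdotZl -mulrDr ler_pM2l//; exact: fg.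
Qed.

Lemma sum_continuous : continuous dF.
Proof.
move=> y; apply: cvg_big => [|i _]; first exact: add_continuous.
apply: cvgZl_tmp.
exact: (cocoercive_continuous beta_gt0 (gc i)).
Qed.

Lemma iterate_in n : C (x n).
Proof. by case: n => [//|n]; rewrite x_step; exact: proj_set_in. Qed.

Section fixed_solution.
Variable z : H.
Hypothesis z_sol : argmin C F z.

Let Tz i := z - gamma *: g i z.

Let sum_Tz : \sum_i w i *: Tz i - z = - (gamma *: dF z).
Proof.
rewrite /Tz /dF scaler_sumr; under eq_bigr do rewrite scalerBr.
rewrite sumrB -scaler_suml w_sum scale1r addrAC subrr sub0r.
by congr (- _); apply: eq_bigr => i _; rewrite !scalerA mulrC.
Qed.

(** By [sum_Tz], the inequality that characterizes the projection is [gamma] times the first-order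
    condition at [z]. *)
Let proj_Tz : proj_set C (\sum_i w i *: Tz i) = z.
Proof.
have [Cz _] := z_sol.
apply: proj_set_unique => // y Cy.
rewrite sum_Tz hdotNl hdotZl oppr_le0 pmulr_rge0//.
exact: (argmin_variational Ccvx sum_subgradient sum_continuous z_sol).
Qed.

(** Each step is indexed by [n + K] so that every block has been activated since [n] and [t_init] no
    longer enters. *)
Let last_ex n : exists l : 'I_m -> nat, forall i,
  [/\ (n <= l i <= n + K)%N, t (n + K)%N i = x (l i) - gamma *: g i (x (l i)) &
      I (n + K)%N i -> l i = (n + K)%N].
Proof.
suff /choice[l lP] : forall i, exists l, [/\ (n <= l <= n + K)%N,
    t (n + K)%N i = x l - gamma *: g i (x l) & I (n + K)%N i -> l = (n + K)%N].
  by exists l.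
move=> i; have [k kK Ik] := I_cover n i.
have nk : (n + k <= n + K)%N by rewrite leq_add2l.
have [l [/andP[l1 l2] tl lI]] :=
  last_activation (T := fun i y => y - gamma *: g i y) t_active t_idle Ik nk.
by exists l; split=> //; rewrite l2 andbT (leq_trans _ l1)// leq_addr.
Qed.

Let l n : 'I_m -> nat := projT1 (cid (last_ex n)).
Let lP n i : [/\ (n <= l n i <= n + K)%N,
  t (n + K)%N i = x (l n i) - gamma *: g i (x (l n i)) &
  I (n + K)%N i -> l n i = (n + K)%N].
Proof. exact: (projT2 (cid (last_ex n))). Qed.

(* Residuals of the step from [n + K] to [n + K + 1], which uses the activations
   [l n i] in the window from [n] to [n + K]. *)
Let De n i := g i (x (l n i)) - g i z.
Let e n i := t (n + K)%N i - Tz i.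
Let eb n := \sum_i w i *: e n i.
Let q n := \sum_i w i *: t (n + K)%N i - x (n + K).+1 -
           (\sum_i w i *: Tz i - z).
Let kap := gamma * (2 * beta - gamma).

Let res n := \sum_i w i * (kap * `|De n i| ^+ 2 + `|e n i - eb n| ^+ 2) + `|q n| ^+ 2.

Let kap_gt0 : 0 < kap. Proof. by rewrite mulr_gt0// subr_gt0. Qed.

Let eE n i : e n i = x (l n i) - z - gamma *: De n i.
Proof.
rewrite /e /Tz /De; have [_ -> _] := lP n i.
by rewrite scalerBr !opprB addrACA [RHS]addrACA [- z + _]addrC.
Qed.

(** Cocoercivity bounds the cross term [2 * gamma * '[De n i, x (l n i) - z]] below by
    [2 * gamma * beta * |De n i|^2]; with the square of the step this leaves [kap]. *)
Let e_le n i : `|e n i| ^+ 2 + kap * `|De n i| ^+ 2 <= `|x (l n i) - z| ^+ 2.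
Proof.
rewrite eE normB_sqr normrZ exprMn real_normK ?num_real// hdotZr.
have : gamma * (beta * `|De n i| ^+ 2) <= gamma * '[De n i, x (l n i) - z].
  by rewrite ler_pM2l//; exact: gc.
by rewrite (hdotC (De n i)) /kap; lra.
Qed.

(** The three losses in [res] come from cocoercivity, from the variance identity and from the firm
    nonexpansiveness of the projection. *)
Let descent n : `|x (n + K).+1 - z| ^+ 2 + res n <=
  \sum_i w i * `|x (l n i) - z| ^+ 2.
Proof.
have := proj_set_firm C0 Ccl Ccvx (\sum_i w i *: t (n + K)%N i) (\sum_i w i *: Tz i).
rewrite proj_Tz -x_step -/(q n).
have -> : \sum_i w i *: t (n + K)%N i - \sum_i w i *: Tz i = eb n.
  by rewrite -sumrB; apply: eq_bigr => i _; rewrite -scalerBr.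
have := weighted_variance w_sum (e n); rewrite -/(eb n) => h1 h2.
have : \sum_i w i * (`|e n i| ^+ 2 + kap * `|De n i| ^+ 2) <=
       \sum_i w i * `|x (l n i) - z| ^+ 2.
  by apply: ler_sum => i _; rewrite ler_pM2l// e_le.
have split2 (a b : 'I_m -> R) :
    \sum_i w i * (a i + b i) = \sum_i w i * a i + \sum_i w i * b i.
  by rewrite -big_split; apply: eq_bigr => i _; rewrite mulrDr.
by rewrite /res !split2; lra.
Qed.

Let w_min : exists2 w0, 0 < w0 <= 1 & forall i, w0 <= w i.
Proof.
exists (\big[Num.min/1]_i w i); last by move=> i; exact: bigmin_le.
by rewrite bigmin_le_id andbT; apply/bigmin_gtP; split.
Qed.

Let distance_residual_cvg : cvgn (fun n => `|x n - z| ^+ 2) /\ res @ \oo --> 0.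
Proof.
have [w0 /andP[w0_gt0 w0_le1] w0_le] := w_min.
apply: (windowed_descent_cvg (K := K) _ _ w0_gt0 w0_le1) => n; rewrite ?sqr_ge0//.
  rewrite /res addr_ge0 ?sqr_ge0// sumr_ge0// => i _.
  apply: mulr_ge0; first exact: ltW.
  by apply: addr_ge0; rewrite ?sqr_ge0// mulr_ge0 ?sqr_ge0// ltW.
set W := \big[Num.max/0]_(k < K.+1) _.
have aW k : (n <= k <= n + K)%N -> `|x k - z| ^+ 2 <= W.
  move=> /andP[nk kn]; have kK : (k - n < K.+1)%N by rewrite ltnS leq_subLR.
  have := le_bigmax 0 (fun k : 'I_K.+1 => `|x (n + k)%N - z| ^+ 2) (Ordinal kK).
  by rewrite /= subnKC.
rewrite addnS; apply: (le_trans (descent n)).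
(* A block active at [n + K] reads [x (n + K)], which thus has weight at least [w0]; the other
   squared distances are at most [W]. *)
have [i0 Ii0] := I_neq0 (n + K)%N.
have [_ _ /(_ Ii0) li0] := lP n i0.
have W1 : `|x (n + K)%N - z| ^+ 2 <= W by rewrite aW// leq_addr leqnn.
have : \sum_i w i * (W - `|x (l n i) - z| ^+ 2) >= w0 * (W - `|x (n + K)%N - z| ^+ 2).
  rewrite (bigD1 i0)//= li0.
  have : w0 * (W - `|x (n + K)%N - z| ^+ 2) <= w i0 * (W - `|x (n + K)%N - z| ^+ 2).
    by rewrite ler_wpM2r// subr_ge0.
  move=> /le_trans; apply; rewrite lerDl sumr_ge0// => i _.
  apply: mulr_ge0; first exact: ltW.
  by rewrite subr_ge0 aW//; case: (lP n i).
under [X in _ <= X -> _]eq_bigr do rewrite mulrBr.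
by rewrite sumrB -mulr_suml w_sum; lra.
Qed.

Let sum_term_cvg0 (u : nat -> 'I_m -> R) i : (forall n j, 0 <= u n j) ->
  (forall n, w i * u n i <= res n) -> u n i @[n --> \oo] --> 0.
Proof.
move=> u0 ur; have [_ r0] := distance_residual_cvg.
have wr : (w i)^-1 * res n @[n --> \oo] --> 0.
  by rewrite -[X in _ --> X](mulr0 (w i)^-1); apply: cvgM => //; exact: cvg_cst.
apply: (squeeze_cvgr _ (cvg_cst 0) wr); apply: nearW => n.
by rewrite u0 /= ler_pdivlMl.
Qed.

Let term_ge0 n j : 0 <= kap * `|De n j| ^+ 2 + `|e n j - eb n| ^+ 2.
Proof. by apply: addr_ge0; rewrite ?sqr_ge0// mulr_ge0 ?sqr_ge0// ltW. Qed.

Let term_le n i : w i * (kap * `|De n i| ^+ 2 + `|e n i - eb n| ^+ 2) <= res n.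
Proof.
rewrite /res ler_wpDr ?sqr_ge0// (bigD1 i)//= lerDl.
by apply: sumr_ge0 => j _; rewrite mulr_ge0 ?term_ge0// ltW.
Qed.

Let De_cvg0 i : `|De n i| @[n --> \oo] --> 0.
Proof.
apply: sqr_cvg0 => //.
have h : kap * `|De n i| ^+ 2 @[n --> \oo] --> 0.
  apply: (sum_term_cvg0 (u := fun n j => kap * `|De n j| ^+ 2)) => [n j|n].
    by rewrite mulr_ge0 ?sqr_ge0// ltW.
  by apply: le_trans (term_le n i); rewrite ler_pM2l// lerDl sqr_ge0.
have -> : (fun n => `|De n i| ^+ 2) = (fun n => kap^-1 * (kap * `|De n i| ^+ 2)).
  by apply/funext => n; rewrite mulKf// gt_eqF.
by rewrite -[X in _ --> X](mulr0 kap^-1); apply: cvgM => //; exact: cvg_cst.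
Qed.

Let eb_cvg0 i : `|e n i - eb n| @[n --> \oo] --> 0.
Proof.
apply: sqr_cvg0 => //.
apply: (sum_term_cvg0 (u := fun n j => `|e n j - eb n| ^+ 2)) => [n j|n].
  exact: sqr_ge0.
by apply: le_trans (term_le n i); rewrite ler_pM2l// lerDr mulr_ge0 ?sqr_ge0// ltW.
Qed.

Let q_cvg0 : `|q n| @[n --> \oo] --> 0.
Proof.
apply: sqr_cvg0 => //; have [_ r0] := distance_residual_cvg.
apply: (squeeze_cvgr _ (cvg_cst 0) r0); apply: nearW => n.
rewrite sqr_ge0 /= /res lerDr sumr_ge0// => j _.
by rewrite mulr_ge0 ?term_ge0// ltW.
Qed.

Let rho n := \sum_i (`|e n i - eb n| + gamma * `|De n i|).

Let rho_cvg0 : rho @ \oo --> 0.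
Proof.
have -> : 0 = \sum_(i < m) (0 + gamma * 0) :> R.
  by rewrite mulr0 addr0 big1.
apply: cvg_big => [|i _]; first exact: add_continuous.
by apply: cvgD => //; apply: cvgM => //; exact: cvg_cst.
Qed.

Let rho_ge n i : `|x (l n i) - z - eb n| <= rho n.
Proof.
have -> : x (l n i) - z - eb n = (e n i - eb n) + gamma *: De n i.
  by rewrite eE [RHS]addrAC subrK.
apply: (le_trans (ler_normD _ _)); rewrite normrZ (gtr0_norm gamma_gt0).
rewrite /rho (bigD1 i)//= lerDl sumr_ge0// => j _.
by rewrite addr_ge0// mulr_ge0// ltW.
Qed.

(** All iterates read at this step are within [rho n] of [z + eb n], and an active block reads
    [x (n + K)] itself. *)
Let last_close n i : `|x (n + K)%N - x (l n i)| <= 2 * rho n.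
Proof.
have [i0 Ii0] := I_neq0 (n + K)%N.
have [_ _ /(_ Ii0) li0] := lP n i0.
have h0 := rho_ge n i0; have h1 := rho_ge n i; rewrite li0 in h0.
have -> : x (n + K)%N - x (l n i) =
    (x (n + K)%N - z - eb n) - (x (l n i) - z - eb n).
  by rewrite opprD addrACA subrr addr0 opprD addrACA subrr addr0.
by apply: (le_trans (ler_normB _ _)); lra.
Qed.

Let shift_cvg0 (V : normedModType R) (u : nat -> V) k :
  (fun n => `|u (n + k)%N|) @ \oo --> 0 -> u @ \oo --> 0.
Proof. by move=> u0; rewrite -(cvg_shiftn k); exact: norm_cvg0. Qed.

(** [De] controls the gradient at the delayed iterate; the Lipschitz bound and [last_close] transfer
    this to [x (n + K)]. *)
Lemma gradient_cvg i : g i (x n) @[n --> \oo] --> g i z.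
Proof.
apply/subr_cvg0/(shift_cvg0 (k := K)).
have h : `|De n i| + beta^-1 * (2 * rho n) @[n --> \oo] --> 0.
  rewrite -[X in _ --> X](_ : 0 + beta^-1 * (2 * 0) = 0); last by rewrite !mulr0 addr0.
  by apply: cvgD => //; do 2 (apply: cvgM; first exact: cvg_cst).
apply: (squeeze_cvgr _ (cvg_cst 0) h); apply: nearW => n; rewrite normr_ge0 /=.
rewrite (_ : g i (x (n + K)%N) - g i z = De n i + (g i (x (n + K)%N) - g i (x (l n i)))).
  apply: (le_trans (ler_normD _ _)); rewrite lerD2l.
  apply: (le_trans (cocoercive_lipschitz beta_gt0 (gc i) _ _)).
  by rewrite ler_pM2l ?invr_gt0.
by rewrite /De [RHS]addrC addrA subrK.
Qed.

Lemma distance_cvg : cvgn (fun n => `|x n - z| ^+ 2).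
Proof. by case: distance_residual_cvg. Qed.

Lemma iterate_bounded : exists M, forall n, `|x n| <= M.
Proof.
have [M [_ MP]] := cvg_seq_bounded distance_cvg.
exists (`|M| + 2 + `|z|) => n.
have h : `|x n - z| ^+ 2 <= `|M| + 1.
  rewrite -[leLHS]ger0_norm ?sqr_ge0//; apply: MP => //.
  by rewrite (le_lt_trans (ler_norm _))// ltrDl.
have h2 : `|x n - z| <= `|M| + 2.
  have M0 : 0 <= `|M| by []. have n0 : 0 <= `|x n - z| by [].
  by rewrite leNgt; apply/negP => c; nra.
by rewrite -(subrK z (x n)) (le_trans (ler_normD _ _))// lerD2r.
Qed.

(** The projection inequality at step [n + K], tested at [z]: the vector before projection minus its
    projection is [q n - gamma *: dF z]. *)
Let vi_le n : gamma * '[dF z, x (n + K).+1 - z] <= `|q n| * `|x (n + K).+1 - z|.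
Proof.
have [Cz _] := z_sol.
have := proj_set_hdot_le0 C0 Ccl Ccvx (\sum_i w i *: t (n + K)%N i) Cz.
rewrite -x_step.
have -> : \sum_i w i *: t (n + K)%N i - x (n + K).+1 = q n - gamma *: dF z.
  by rewrite /q sum_Tz opprK addrK.
rewrite -(opprB (x _)) hdotNr hdotBl hdotZl => h.
by apply: (le_trans _ (hdot_le (q n) (x (n + K).+1 - z))); lra.
Qed.

(** Nonnegative by minimality of [z]; from above, [dF (x n)] is split into [dF (x n) - dF z], which
    tends to 0, and [dF z], handled by [vi_le]. *)
Lemma gap_cvg0 : '[dF (x n), x n - z] @[n --> \oo] --> 0.
Proof.
have [M xM] := iterate_bounded.
have [_ zmin] := z_sol.
have gap0 n : 0 <= '[dF (x n), x n - z].
  have := sum_subgradient (x n) z; have := zmin _ (iterate_in n).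
  by rewrite -(opprB (x n)) hdotNr; lra.
have dFz : dF (x n) @[n --> \oo] --> dF z.
  apply: cvg_big => [|i _]; first exact: add_continuous.
  by apply: cvgZl_tmp; exact: gradient_cvg.
have dF0 : `|dF (x (n + K.+1)%N) - dF z| @[n --> \oo] --> 0.
  rewrite -[X in _ --> X](normr0 H) -(subrr (dF z)).
  apply: cvg_norm; apply: cvgB; last exact: cvg_cst.
  by rewrite (cvg_shiftn K.+1 (fun n => dF (x n))).
apply: (shift_cvg0 (V := R^o) (k := K.+1)).
have h : (`|dF (x (n + K.+1)%N) - dF z| + gamma^-1 * `|q n|) * (M + `|z|) @[n --> \oo] --> 0.
  rewrite -[X in _ --> X](_ : (0 + gamma^-1 * 0) * (M + `|z|) = 0); last by ring.
  apply: cvgM; last exact: cvg_cst.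
  by apply: cvgD => //; apply: cvgM => //; exact: cvg_cst.
apply: (squeeze_cvgr _ (cvg_cst 0) h); apply: nearW => n; rewrite normr_ge0 /=.
rewrite ger0_norm// addnS.
have h1 := hdot_le (dF (x (n + K).+1) - dF z) (x (n + K).+1 - z).
have h2 : '[dF z, x (n + K).+1 - z] <= gamma^-1 * `|q n| * `|x (n + K).+1 - z|.
  by rewrite -mulrA ler_pdivlMl// vi_le.
have xz : `|x (n + K).+1 - z| <= M + `|z| by rewrite (le_trans (ler_normB _ _))// lerD2r.
have c0 : 0 <= `|dF (x (n + K).+1) - dF z| + gamma^-1 * `|q n|.
  by rewrite addr_ge0// mulr_ge0// invr_ge0 ltW.
apply: le_trans (ler_wpM2l c0 xz).
by move: h1; rewrite hdotBl mulrDl; lra.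
Qed.

End fixed_solution.

(** Since [F (x n)] exceeds the minimum [F z] by at most the gap, weak lower semicontinuity makes
    [y] optimal. *)
Let ultra_limit_argmin z (U : set_system nat) y (UU : UltraFilter U) :
  argmin C F z -> \oo `<=` U -> weakly_to U x y -> argmin C F y.
Proof.
move=> z_sol sU xy; have [Cz zmin] := z_sol.
split; first exact: (weakly_to_closed_convex C0 Ccl Ccvx iterate_in xy).
move=> u Cu; apply: (le_trans _ (zmin _ Cu)).
apply: (weakly_to_le sum_subgradient xy (v := fun n => F z + '[dF (x n), x n - z])).
  move=> n; have := sum_subgradient (x n) z.
  by rewrite -(opprB (x n)) hdotNr; lra.
rewrite -[X in _ --> X]addr0; apply: cvgD; first exact: cvg_cst.
by apply: cvg_trans (gap_cvg0 z_sol) => A hA; exact: sU.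
Qed.

(* Opial: the distances to two weak cluster points both converge, so the inner
   products with their difference converge as well. *)
Lemma iterate_weak_cvg : (exists z, argmin C F z) ->
  exists z, argmin C F z /\ weak_cvg x z.
Proof.
move=> [z0 z0_sol]; have [M xM] := iterate_bounded z0_sol.
have [U0 [UU0 sU0]] := @ultraFilterLemma nat \oo _.
have [z xz] := ultra_weakly_to (U := U0) xM.
have z_sol := ultra_limit_argmin UU0 z0_sol sU0 xz.
exists z; split; first exact: z_sol.
move=> y; apply: ultra_cvg => U UU sU.
have [z' xz'] := ultra_weakly_to (U := U) xM.
have z'_sol := ultra_limit_argmin UU z0_sol sU xz'.
suff zz : z' = z by rewrite zz in xz'; exact: xz'.
have [c xc] : exists c : R, '[x n, z' - z] @[n --> \oo] --> c.
  have /cvg_ex[a ha] := distance_cvg z_sol; have /cvg_ex[b hb] := distance_cvg z'_sol.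
  exists (2^-1 * (a - b + (`|z'| ^+ 2 - `|z| ^+ 2))).
  have -> : (fun n => '[x n, z' - z]) = (fun n => 2^-1 *
      (`|x n - z| ^+ 2 - `|x n - z'| ^+ 2 + (`|z'| ^+ 2 - `|z| ^+ 2))).
    by apply/funext => n; rewrite !normB_sqr hdotBr; field.
  apply: cvgM; first exact: cvg_cst.
  by apply: cvgD; [exact: cvgB|exact: cvg_cst].
have e1 : '[z, z' - z] = c.
  apply: (cvg_unique _ (xz _)) => //=.
  by apply: cvg_trans xc => A hA; exact: sU0.
have e2 : '[z', z' - z] = c.
  apply: (cvg_unique _ (xz' _)) => //=.
  by apply: cvg_trans xc => A hA; exact: sU.
apply/eqP; rewrite -subr_eq0; apply/eqP/hdotx_eq0.
by rewrite hdotBl e1 e2 subrr.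
Qed.

End block_iteration.

(** * Closed range, coercivity and strong convergence *)

Section closed_range.
Context {R : realType} {H G : hilbertType R} (L : {linear H -> G}).
Hypotheses (Lb : bounded_near L (nbhs (0 : H))) (Lcl : closed (range L)).

Let V := range L.
Let V0 : V !=set0. Proof. by exists (L 0), 0. Qed.
Let Vcvx : convex_set V.
Proof.
move=> u v s; rewrite !inE => -[x _ <-] [y _ <-].
by exists (s%:num *: x + (1 - s%:num) *: y); rewrite // linearD !linearZ.
Qed.

Let projV_shift y v : V v -> proj_set V (y + v) = proj_set V y + v.
Proof.
move=> [a _ <-]; apply: proj_set_unique => //.
  have [b _ <-] := proj_set_in V0 Lcl Vcvx y.
  by exists (b + a); rewrite // linearD.
move=> _ [c _ <-]; rewrite opprD addrACA subrr addr0.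
rewrite [- _ - _]addrC addrA -linearB.
by apply: proj_set_hdot_le0 => //; exists (c - a).
Qed.

Let projV_continuous : continuous (proj_set V).
Proof.
apply: (@lipschitz_le_continuous _ _ _ _ 1) => x y; rewrite mul1r.
rewrite -(@ler_pXn2r _ 2%N) ?nnegrE//.
by apply: (le_trans (proj_set_firm V0 Lcl Vcvx x y)); rewrite gerBl sqr_ge0.
Qed.

(** Pulled back by the projection, the images of balls become subsets of the whole of [G], where
    Baire's theorem applies. *)
Let image_ball (n : nat) := [set y | exists2 b, `|b| <= n%:R & proj_set V y = L b].

(* [L] maps closed balls to closed sets, as these are weakly compact. *)
Let image_ball_closed n : closed (image_ball n).
Proof.
move=> y clBy.
have PF : ProperFilter (within (image_ball n) (nbhs y)).
  split; last exact: within_filter.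
  by move=> /clBy[v [Bv]]; apply.
have [U [UU sU]] := ultraFilterLemma PF.
have UB : U (image_ball n) by apply: sU; rewrite /within/=; exact: filterE.
have yU : nbhs y `<=` U.
  by move=> A yA; apply: sU; apply: (@filterS _ (nbhs y) _ A) yA => v.
(* The value 0 off [image_ball n] makes [b] total and bounded; [U] contains [image_ball n]. *)
have /choice[b bP] v : exists b, `|b| <= n%:R /\ (image_ball n v -> proj_set V v = L b).
  have [[b bn Pb]|nB] := pselect (image_ball n v); first by exists b.
  by exists 0; rewrite normr0 ler0n.
have [z bz] := ultra_weakly_to (U := U) (fun v => (bP v).1).
exists z; first exact: (weakly_to_norm_le (fun v => (bP v).1) bz).
have PU : proj_set V v @[v --> U] --> proj_set V y.
  by apply: cvg_trans (projV_continuous (x := y)) => A hA; exact: yU.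
apply: hdot_extl => u.
apply: (cvg_unique _ (cvg_hdotl (z := u) PU)) => //=.
apply: cvg_trans (weakly_to_adjoint Lb bz (x := u)).
apply: near_eq_cvg; apply: filterS UB => v Bv.
by rewrite (proj2 (bP v)).
Qed.

(** Open mapping argument: the sets [image_ball n] cover [G], so one of them contains a ball. *)
Lemma closed_range_bounded_below :
  exists M, forall x, orthogonal_complement (ker_set L) x -> `|x| <= M * `|L x|.
Proof.
have [n [y0 [r r0 ballB]]] : exists n y0, exists2 r, 0 < r & ball y0 r `<=` image_ball n.
  apply: contrapT => nB.
  have : forall n, open (~` image_ball n) /\ dense (~` image_ball n).
    move=> n; split; first exact/closed_openC/image_ball_closed.
    move=> O [y Oy] Oo; apply: contrapT => OB; apply: nB.
    have /nbhs_ballP[r r0 yr] : nbhs y O by exact: open_nbhs_nbhs.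
    exists n, y, r => // v /yr Ov; apply: contrapT => nBv.
    by apply: OB; exists v.
  move=> /Baire /(_ setT); case.
  - by exists 0.
  - exact: openT.
  - move=> y [_ nBy]; have [b _ Lby] := proj_set_in V0 Lcl Vcvx y.
    apply: (nBy (Num.bound `|b|) I); exists b => //.
    exact/ltW/archi_boundP.
exists (4 * n%:R / r) => x xk.
have [Lx0|Lx0] := eqVneq (L x) 0.
  have -> : x = 0 by apply: hdotx_eq0; exact: xk.
  by rewrite linear0 !normr0 mulr0.
have Lx : 0 < `|L x| by rewrite normr_gt0.
have [b0 b0n Pb0] : image_ball n y0 by apply: ballB; exact: ballxx.
(* This scaling gives [L (s *: x)] norm [r / 2], so [y0 + L (s *: x)] stays in the ball. *)
pose s := r / 2 / `|L x|.
have s0 : 0 < s by rewrite !divr_gt0.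
have [b1 b1n Pb1] : image_ball n (y0 + L (s *: x)).
  apply: ballB; rewrite -ball_normE /ball_/= opprD addrA subrr sub0r normrN.
  rewrite linearZ/= normrZ gtr0_norm// /s divfK ?gt_eqF//; lra.
rewrite projV_shift in Pb1; last by exists (s *: x).
(* [s *: x] and [b1 - b0] differ by an element of the kernel, to which [x] is orthogonal; as
   [|b1 - b0| <= 2 n], this bounds [s * |x|] by [2 n]. *)
have k : ker_set L (s *: x - (b1 - b0)).
  by rewrite /ker_set/= (linearB L) (linearB L) -Pb1 -Pb0 [_ + L _]addrC addrK subrr.
have := xk _ k; rewrite hdotBr hdotZr -sqr_norm_hdot => /eqP; rewrite subr_eq0 => /eqP e.
have h : s * `|x| ^+ 2 <= `|x| * (2 * n%:R).
  rewrite e (le_trans (hdot_le _ _))// ler_wpM2l//.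
  by rewrite (le_trans (ler_normB _ _))//; lra.
have {}h : s * `|x| <= 2 * n%:R.
  have [->|x0] := eqVneq x 0; first by rewrite normr0 mulr0 mulr_ge0.
  have x1 : 0 < `|x| by rewrite normr_gt0.
  by rewrite -(ler_pM2l x1) (le_trans _ h)// expr2 mulrCA.
rewrite mulrAC ler_pdivlMr// mulrC.
move: h; rewrite /s mulrAC ler_pdivrMr//; lra.
Qed.

End closed_range.

Lemma bounded_set_le (R : realType) (V : normedModType R) (A : set V) :
  bounded_set A -> exists M, forall x, A x -> `|x| <= M.
Proof.
move=> [M [_ MA]]; exists (M + 1) => x Ax; apply: (MA _ _ x Ax).
by rewrite ltrDl.
Qed.

Section coercivity.
Context {R : realType} {H G : hilbertType R} (C : set H) (L : H -> G) (D : set G)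
  (phi : R -> R).

Definition coercive_on (f : H -> R) :=
  forall B, exists M, forall x, C x -> f x <= B -> `|x| <= M.

Lemma coercive_on_cvg (f : H -> R) :
  (iota_set C x + (f x)%:E)%E @[x --> norm_pinfty H] --> +oo%E -> coercive_on f.
Proof.
move=> foo B.
have [N _ NB] : norm_pinfty H [set x | (B%:E < iota_set C x + (f x)%:E)%E].
  by apply: (foo [set y | (B%:E < y)%E]); exists B; split=> //; exact: num_real.
exists N => x Cx fB; rewrite leNgt; apply/negP => /NB /=.
by rewrite /iota_set mem_set// add0e lte_fin ltNge fB.
Qed.

Hypotheses (D0 : D !=set0) (Dcl : closed D) (Dcvx : convex_set D).
Hypotheses (phi_ge0 : forall s, 0 <= phi s)
  (phi_convex : convex_function (E := R^o) [set: R] phi)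
  (phi_eq0 : forall s, phi s = 0 <-> s = 0).

Lemma coercive_on_bounded_below M : bounded_set D ->
  (forall x, C x -> `|x| <= M * `|L x|) ->
  coercive_on (fun x => phi (dist_set D (L x))).
Proof.
move=> /bounded_set_le[r rD] LM B.
have p1 := loss1_gt0 phi_ge0 phi_eq0.
(* [Q] bounds the distance: either it is at most 1, or linear growth bounds its product with [phi 1]
   by [B]. *)
pose Q := 1 + `|B| / phi 1.
exists (`|M| * (Q + r)) => x Cx xB.
have dQ : dist_set D (L x) <= Q.
  have [d1|/ltW d1] := leP (dist_set D (L x)) 1.
    by rewrite (le_trans d1)// lerDl divr_ge0// ltW.
  have := loss_linear_growth phi_convex phi_eq0 d1 => h.
  apply: ler_wpDl => //; rewrite ler_pdivlMr// mulrC (le_trans h)// (le_trans xB)//.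
  exact: ler_norm.
have Lx : `|L x| <= Q + r.
  rewrite -(subrK (proj_set D (L x)) (L x)) (le_trans (ler_normD _ _))//.
  by rewrite -dist_setE// lerD// rD//; exact: proj_set_in.
rewrite (le_trans (LM _ Cx))// (@le_trans _ _ (`|M| * `|L x|))//.
  by rewrite ler_wpM2r// ler_norm.
by rewrite ler_wpM2l.
Qed.

End coercivity.

Lemma is_Id_norm (R : realType) (H G : hilbertType R) (L : H -> G) x :
  is_Id L -> `|L x| = `|x|.
Proof. by move=> [e ->]; case: _ / e. Qed.

Section strong_convergence.
Context {R : realType} {H : hilbertType R} (x : nat -> H) (z : H).
Hypothesis xz : weak_cvg x z.

Lemma weak_cvg_ultra (U : set_system nat) : \oo `<=` U -> weakly_to U x z.
Proof. by move=> sU y; apply: cvg_trans (xz (z := y)) => A hA; exact: sU. Qed.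

(** Along an ultrafilter, compactness gives a strong limit, which has to be the weak limit [z]. *)
Lemma weak_cvg_boundedly_compact (C : set H) M : boundedly_compact C ->
  (forall n, C (x n)) -> (forall n, `|x n| <= M) -> x @ \oo --> z.
Proof.
move=> Cc xC xM; apply: ultra_cvg => U UU sU.
have M0 : 0 < `|M| + 1 by rewrite ltr_wpDl.
have [|p _ xp] := ultra_cvg_compact (U := U) (u := x) (Cc 0 _ M0).
  move=> n; split => //; rewrite closed_ballE// /closed_ball_/= sub0r normrN.
  by rewrite (le_trans (xM n))// (le_trans (ler_norm _))// lerDl.
suff -> : z = p by [].
exact: (weakly_to_unique (weak_cvg_ultra sU) (cvg_weakly_to xp)).
Qed.

(* Along an ultrafilter, compactness of [D] makes [proj_set D (L (x n))], hence
   [adjoint L (L (x n))], converge strongly. *)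
Lemma weak_cvg_compact_target (G : hilbertType R) (L : {linear H -> G})
    (D : set G) (M k : R) (h : H) :
  bounded_near L (nbhs (0 : H)) -> D !=set0 -> closed D -> convex_set D ->
  compact D -> (forall n, `|x n| <= M) -> (forall n, `|x n - z| <= k * `|L (x n - z)|) ->
  adjoint L (L (x n) - proj_set D (L (x n))) @[n --> \oo] --> h ->
  x @ \oo --> z.
Proof.
move=> Lb D0 Dcl Dcvx Dc xM xk gh; apply: ultra_cvg => U UU sU.
have [p _ Pp] := ultra_cvg_compact (U := U) Dc
  (fun n => proj_set_in D0 Dcl Dcvx (L (x n))).
have Ac : continuous (adjoint L).
  apply: (@lipschitz_le_continuous _ _ _ _ (opnorm L)) => u v.
  by rewrite -(adjointB Lb) adjoint_norm_le.
have LLh : adjoint L (L (x n)) @[n --> U] --> h + adjoint L p.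
  have -> : (fun n => adjoint L (L (x n))) = (fun n =>
      adjoint L (L (x n) - proj_set D (L (x n))) + adjoint L (proj_set D (L (x n)))).
    by apply/funext => n; rewrite (adjointB Lb) subrK.
  apply: cvgD; first by apply: cvg_trans gh => A hA; exact: sU.
  by apply: (continuous_cvg _ _ Pp); exact: Ac.
have LLz : h + adjoint L p = adjoint L (L z).
  apply: (weakly_to_unique (cvg_weakly_to LLh)) => y.
  under eq_fun do rewrite hdotC -(adjointP Lb) hdotC.
  by rewrite hdotC -(adjointP Lb) hdotC; apply: weakly_to_adjoint => //; exact: weak_cvg_ultra.
rewrite {}LLz in LLh.
(* [|L (x n - z)|^2] is the inner product of the bounded [x n - z] with [adjoint L (L (x n - z))],
   which tends to 0. *)
have L0 : `|L (x n - z)| @[n --> U] --> 0.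
  apply: sqr_cvg0 => //.
  have h0 : (M + `|z|) * `|adjoint L (L (x n)) - adjoint L (L z)| @[n --> U] --> 0.
    rewrite -[X in _ --> X](mulr0 (M + `|z|)) -(normr0 H) -(subrr (adjoint L (L z))).
    apply: cvgM; first exact: cvg_cst.
    by apply: cvg_norm; apply: cvgB => //; exact: cvg_cst.
  apply: (squeeze_cvgr _ (cvg_cst 0) h0); apply: nearW => n; rewrite sqr_ge0/=.
  rewrite sqr_norm_hdot (adjointP Lb) linearB (adjointB Lb).
  rewrite (le_trans (hdot_le _ _))// ler_wpM2r//.
  by rewrite (le_trans (ler_normB _ _))// lerD2r.
have k0 : k * `|L (x n - z)| @[n --> U] --> 0.
  by rewrite -[X in _ --> X](mulr0 k); apply: cvgM => //; exact: cvg_cst.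
have x0 : `|x n - z| @[n --> U] --> 0.
  by apply: (squeeze_cvgr _ (cvg_cst 0) k0); apply: nearW => n; rewrite normr_ge0 /=.
by apply/subr_cvg0; apply: norm_cvg0.
Qed.

End strong_convergence.

(** * Application to the losses of the distances to the [D i] *)

Theorem corollary4p16 (R : realType) (H : hilbertType R) (m : nat) (m_gt0 : (0 < m)%N)
  (omega : 'I_m -> R)
  (omega_itv : forall i, 0 < omega i <= 1)
  (omega_sum : \sum_(i < m) omega i = 1)
  (C0 : set H)
  (C0_neq0 : C0 !=set0) (C0_closed : closed C0) (C0_convex : convex_set C0)
  (G : 'I_m -> hilbertType R)
  (L : forall i, {linear H -> G i})
  (L_bounded : forall i, bounded_near (L i) (nbhs (0 : H)))
  (L_neq0 : forall i, exists x, L i x != 0)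
  (D : forall i, set (G i))
  (D_neq0 : forall i, D i !=set0)
  (D_closed : forall i, closed (D i))
  (D_convex : forall i, convex_set (D i))
  (mu : 'I_m -> R)
  (mu_gt0 : forall i, 0 < mu i)
  (phi : 'I_m -> R -> R)
  (phi_ge0 : forall i s, 0 <= phi i s)
  (phi_even : forall i s, phi i (- s) = phi i s)
  (phi_derivable : forall i s, derivable (phi i) s 1)
  (phi_convex : forall i, convex_function (E := R^o) [set: R] (phi i))
  (phi_eq0 : forall i s, phi i s = 0 <-> s = 0)
  (phi_lipschitz : forall i, (mu i).-lipschitz (derive1 (phi i)))
  (coercivity :
    [\/ (* a *)
        exists j, (iota_set C0 x + (phi j (dist_set (D j) (L j x)))%:E)%E
                    @[x --> norm_pinfty H] --> +oo%E,
        (* b *)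
        exists j, [/\ closed (range (L j)),
                      C0 `<=` orthogonal_complement (ker_set (L j)) &
                      bounded_set (D j)],
        (* c *)
        exists j, is_Id (L j) /\ bounded_set (D j) |
        (* d *)
        bounded_set C0])
  (beta : R)
  (beta_def : beta = 1 / \big[Num.max/0]_(i < m) (mu i * opnorm (L i) ^+ 2))
  (gamma : R)
  (gamma_itv : 0 < gamma < 2 * beta)
  (K : nat) (K_gt0 : (0 < K)%N)
  (I : nat -> set 'I_m)
  (I_neq0 : forall n, I n !=set0)
  (I_cover : forall n, \bigcup_(k < K) I (n + k)%N = [set: 'I_m])
  (x : nat -> H) (t : nat -> 'I_m -> H)
  (* t_init i is t_{i,-1} *)
  (t_init : 'I_m -> H)
  (x0_in : C0 (x 0%N))
  (t_out : forall n i, I n i -> ~ D i (L i (x n)) ->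
    t n i = x n -
      (gamma * (derive1 (phi i) (dist_set (D i) (L i (x n)))
                / dist_set (D i) (L i (x n))))
      *: adjoint (L i) (L i (x n) - proj_set (D i) (L i (x n))))
  (t_in : forall n i, I n i -> D i (L i (x n)) -> t n i = x n)
  (t_idle : forall n i, ~ I n i ->
    t n i = if n is n'.+1 then t n' i else t_init i)
  (x_step : forall n, x n.+1 = proj_set C0 (\sum_(i < m) omega i *: t n i)) :
  let solution :=
    argmin C0 (fun z => \sum_(i < m) omega i * phi i (dist_set (D i) (L i z))) in
  (exists2 z, solution z & weak_cvg x z) /\
  ((exists j,
      [/\ [/\ closed (range (L j)),
              C0 `<=` orthogonal_complement (ker_set (L j)) &
              bounded_set (D j)],
          forall s, phi j s = mu j * `|s| ^+ 2 / 2 &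
          compact (D j)])
   \/ boundedly_compact C0 ->
   exists2 z, solution z & x @ \oo --> z).
Proof.
move=> solution.
have omega_gt0 i : 0 < omega i by case/andP: (omega_itv i).
pose f i z := phi i (dist_set (D i) (L i z)).
pose g i z := adjoint (L i) (dist_loss_grad (D i) (phi i) (L i z)).
have f_ge0 i z : 0 <= f i z by exact: phi_ge0.
have [j0 _] : exists j : 'I_m, True by exists (Ordinal m_gt0).
pose lam i := mu i * opnorm (L i) ^+ 2.
have lam_gt0 i : 0 < lam i by rewrite mulr_gt0// exprn_gt0// opnorm_gt0.
have lam_le i : lam i <= \big[Num.max/0]_(i < m) lam i by exact: le_bigmax.
have max_gt0 := lt_le_trans (lam_gt0 j0) (lam_le j0).
have beta_gt0 : 0 < beta by rewrite beta_def divr_gt0.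
have beta_lam i : beta * lam i <= 1.
  by rewrite beta_def mul1r mulrC ler_pdivrMr// mul1r.
have [gamma_gt0 gamma_lt] := andP gamma_itv.
have fg i : subgradient (f i) (g i).
  apply: (subgradient_comp (L_bounded i) (h := phi i \o dist_set (D i))).
  exact: (dist_loss_subgradient _ _ _ _ (phi_derivable i) _ _ (mu_gt0 i)).
have gc i : cocoercive beta (g i).
  apply: (cocoercive_comp (psi := dist_loss_grad (D i) (phi i)) (L_bounded i) (mu_gt0 i)
    beta_gt0 (beta_lam i)).
  exact: dist_loss_cocoercive.
(* [K'] is one less than [K]: the abstract iteration uses windows of [K' + 1] indices. *)
case: K K_gt0 I_cover => // K' _ I_cover'.
have I_cover2 n i : exists2 k, (k <= K')%N & I (n + k)%N i.
  by have : [set: 'I_m] i by []; rewrite -(I_cover' n) => -[k /= kK Ik]; exists k.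
(* Both branches of the iteration are the same gradient step, [g i (x n)] being 0 when [L i (x n)]
   is in [D i]. *)
have t_active n i : I n i -> t n i = x n - gamma *: g i (x n).
  move=> Ini; have [Dx|nDx] := pselect (D i (L i (x n))).
    rewrite t_in// /g dist_loss_grad_in// -(subrr 0) adjointB//.
    by rewrite subrr scaler0 subr0.
  by rewrite t_out// /g /dist_loss_grad adjointZ// scalerA.
have xC n : C0 (x n) by exact: iterate_in x_step n.
have F_subgradient : subgradient (fun z => \sum_i omega i * f i z)
    (fun z => \sum_i omega i *: g i z).
  exact: sum_subgradient.
have below_coercive j M : bounded_set (D j) ->
    (forall z, C0 z -> `|z| <= M * `|L j z|) -> coercive_on C0 (f j).
  exact: coercive_on_bounded_below.
(* Differences of points of [C0] are orthogonal to the kernel too, so the bound extends to them. *)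
have bounded_below j : closed (range (L j)) ->
    C0 `<=` orthogonal_complement (ker_set (L j)) ->
    exists M, forall y z, C0 y -> C0 z -> `|y - z| <= M * `|L j (y - z)|.
  move=> Lcl Cker; have [M LM] := closed_range_bounded_below (L_bounded j) Lcl.
  exists M => y z Cy Cz; apply: LM => u Lu.
  by rewrite hdotBl (Cker _ Cy)// (Cker _ Cz)// subrr.
have sol_ex : exists z, solution z.
  apply: (argmin_exists C0_neq0 C0_closed C0_convex F_subgradient) => [z _|].
    by apply: sumr_ge0 => i _; rewrite mulr_ge0// ltW.
  (* One coercive term suffices, the others being nonnegative and [omega j] positive. *)
  have lift j : coercive_on C0 (f j) -> coercive_on C0 (fun z => \sum_i omega i * f i z).
    move=> fj B; have [M MP] := fj (B / omega j); exists M => z Cz FB.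
    apply: MP => //; rewrite ler_pdivlMr// mulrC (le_trans _ FB)//.
    rewrite (bigD1 j)//= lerDl sumr_ge0// => i _.
    by rewrite mulr_ge0// ltW.
  case: coercivity => [[j ja]|[j [Lcl Cker Db]]|[j [LId Db]]|C0b].
  - by apply: (lift j); exact: coercive_on_cvg.
  - apply: (lift j).
    have [M LM] := closed_range_bounded_below (L_bounded j) Lcl.
    by apply: (below_coercive j M Db) => z /Cker; exact: LM.
  - apply: (lift j); apply: (below_coercive j 1 Db) => z _.
    by rewrite mul1r (is_Id_norm _ LId).
  - by move=> B; have [M MP] := bounded_set_le C0b; exists M => z Cz _; exact: MP.
have [z [z_sol xz]] := iterate_weak_cvg omega_gt0 omega_sum C0_neq0 C0_closed
  C0_convex fg gc gamma_gt0 gamma_lt I_neq0 I_cover2 t_active t_idle x0_in x_step sol_ex.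
have [M xM] := iterate_bounded omega_gt0 omega_sum C0_neq0 C0_closed
  C0_convex fg gc gamma_gt0 gamma_lt I_neq0 I_cover2 t_active t_idle x_step z_sol.
split; first by exists z.
case=> [[j [[Lcl Cker Db] phij Dc]]|C0c]; exists z => //; last first.
  exact: (weak_cvg_boundedly_compact xz C0c xC xM).
have gj := gradient_cvg (i := j) omega_gt0 omega_sum C0_neq0 C0_closed
  C0_convex fg gc gamma_gt0 gamma_lt I_neq0 I_cover2 t_active t_idle x_step z_sol.
have [k kP] := bounded_below _ Lcl Cker.
apply: (weak_cvg_compact_target xz (L_bounded j) (D_neq0 j) (D_closed j)
  (D_convex j) Dc xM (k := k) (h := (mu j)^-1 *: g j z)).
  by move=> n; apply: kP => //; case: z_sol.
have dphi s : derive1 (phi j) s = mu j * s.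
  have -> : phi j = (fun s => mu j * s ^+ 2 / 2).
    by apply/funext => r; rewrite phij real_normK ?num_real.
  have ds : is_derive (s : R) 1 (fun s : R => mu j * s ^+ 2 / 2) (mu j * s).
    by apply: is_derive_eq; rewrite /GRing.scale/=; field.
  by rewrite derive1E derive_val.
(* As [phi j] has derivative [mu j * s], the quotient in [dist_loss_grad] is the constant [mu j] off
   [D j]; where the distance is 0, both sides vanish. *)
have gE u : adjoint (L j) (L j u - proj_set (D j) (L j u)) = (mu j)^-1 *: g j u.
  rewrite /g /dist_loss_grad dphi.
  have [d0|d0] := eqVneq (dist_set (D j) (L j u)) 0.
    rewrite -(dist_set_eq0 (D_neq0 j) (D_closed j) (D_convex j) d0) subrr scaler0.
    rewrite -(subrr 0) adjointB// subrr scaler0 //.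
  by rewrite mulfK// adjointZ// scalerA mulVf ?scale1r// gt_eqF.
under eq_fun do rewrite gE.
by apply: cvgZl_tmp.
Qed.
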